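(* Let $G$ be a $3$-connected simple graph with a $3$-connected simple minor $H$. Suppose that $G$ has a free $H$-fan family with rank $r\ge 1$. Then $G$ has a forest (as a subgraph) with $\left\lceil (r+1)/2\right\rceil$ edges, each of which is $H$-contractible in $G$.
   Context: Graphs are finite, nonempty and may have loops and parallel edges. A graph is $k$-connected if the removal of each set of fewer than $k$ vertices leaves a connected graph (no requirement that it has more than $k$ vertices; the null graph counts as connected). An $H$-minor is a minor isomorphic to $H$. For $X\subseteq E(G)$, $G[X]$ is the subgraph with edge set $X$ and vertices the endvertices of edges of $X$; $G/X$ is the contraction of $X$, and $G/F:=G/E(F)$ for a subgraph $F$. An edge $e$ of a $3$-connected graph $G$ is $H$-contractible if $G/e$ is $3$-connected with an $H$-minor. A wye of $G$ is a subgraph isomorphic to the star with $3$ edges, consisting of all the edges of $G$ incident to a degree-$3$ vertex of $G$. A fan of $G$ is a simple subgraph $F$ of $G$ with at least $3$ edges such that $E(F)$ has an ordering $a_0,a_1,\dots,a_{m+1}$ of its distinct edges (a fan ordering) such that for $i=1,\dots,m$ the set $\{a_{i-1},a_i,a_{i+1}\}$ induces a wye or a triangle of $G$, and for $0<i<m$, $\{a_{i-1},a_i,a_{i+1}\}$ induces a wye if and only if $\{a_i,a_{i+1},a_{i+2}\}$ induces a triangle. A fan is wye-to-wye if it has a fan ordering whose first three and whose last three edges induce wyes. Such a fan ordering can be written $x_0,y_1,x_1,\dots,y_n,x_n$ ($n\ge1$), where $y_i=uv_i$ and $x_i=v_iv_{i+1}$, the vertices $v_1,\dots,v_n$ have degree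 $3$ in $G$, and $u,v_0,\dots,v_{n+1}$ are distinct except that possibly $v_0=v_{n+1}$. A wye-to-wye fan is maximal if it is not a proper subgraph of another wye-to-wye fan of $G$. If $x_0,y_1,x_1,\dots,y_n,x_n$ is a fan ordering of a maximal wye-to-wye fan of $G$, then $F:=G[\{y_1,x_1,\dots,x_{n-1},y_n\}]$ is an $H$-inner fan of $G$ provided $G/F$ is $3$-connected with an $H$-minor. Fans are identified with their edge sets when convenient. The rank $r_G(X)$ of $X\subseteq E(G)$ is the number of edges in a spanning forest of $G[X]$. For a family $\mathcal F=\{X_1,\dots,X_k\}$ of subsets of $E(G)$, $G[\mathcal F]:=G[X_1\cup\dots\cup X_k]$ and its rank is $r_G(\mathcal F):=r_G(X_1\cup\dots\cup X_k)$. The family is free if its members are pairwise disjoint and the edge set of each circuit (cycle) of $G[\mathcal F]$ is contained in a member of $\mathcal F$. An $H$-fan family of $G$ is a family of pairwise disjoint subsets of $E(G)$, each of which is the edge set of an $H$-inner fan of $G$ or a singleton consisting of an $H$-contractible edge of $G$. *)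

(* Defs.v *)
From mathcomp Require Import all_boot.

Set Implicit Arguments.
Unset Strict Implicit.
Unset Printing Implicit Defensive.

(* Finite undirected multigraphs: an edge has a set of one end (a loop) or two
   ends, and distinct edges may have the same ends.  The null graph belongs to
   the type, because it occurs as the result of a vertex removal; nonemptiness
   is required where graphs are quantified. *)
Record mgraph := MGraph {
  vert : finType;
  edge : finType;
  ends : edge -> {set vert};
  card_ends : forall e, 0 < #|ends e| <= 2
}.

Definition iso (G H : mgraph) : Prop :=
  exists (f : vert G -> vert H) (g : edge G -> edge H),
    [/\ bijective f, bijective g & forall e, ends (g e) = f @: ends e].

Definition simple (G : mgraph) : Prop :=
  (forall e : edge G, #|ends e| = 2) /\ injective (@ends G).

Definition edges_at (G : mgraph) (v : vert G) : {set edge G} :=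
  [set e | v \in ends e].

(* A loop contributes 2 to the degree of its end. *)
Definition deg (G : mgraph) (v : vert G) : nat :=
  #|edges_at v| + #|[set e in edges_at v | #|ends e| == 1]|.

Definition adj (G : mgraph) (X : {set edge G}) : rel (vert G) :=
  fun x y => [exists e in X, ends e == [set x; y]].

Definition connected (G : mgraph) : bool :=
  [forall x : vert G, forall y : vert G, connect (adj [set: edge G]) x y].

(* The subgraph with vertex set W and with the edges of D whose ends all lie
   in W; every subgraph arises in this way. *)
Section Subgraph.
Variables (G : mgraph) (W : {set vert G}) (D : {set edge G}).

Definition subgraph_ends (e : {e : edge G | (e \in D) && (ends e \subset W)}) :
    {set {x : vert G | x \in W}} :=
  [set x | val x \in ends (val e)].

Lemma card_subgraph_ends e : 0 < #|subgraph_ends e| <= 2.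
Proof.
suff <- : #|ends (val e)| = #|subgraph_ends e| by exact: card_ends.
rewrite -(card_imset _ val_inj); apply: eq_card => x.
apply/idP/imsetP => [xe | [y]]; last by rewrite inE => ye ->.
have /andP[_ /subsetP/(_ x xe) xW] := valP e.
by exists (Sub x xW); rewrite ?inE SubK.
Qed.

Definition subgraph : mgraph := MGraph card_subgraph_ends.
End Subgraph.

Definition del_vertices (G : mgraph) (S : {set vert G}) : mgraph :=
  subgraph (~: S) [set: edge G].

Definition edge_induced (G : mgraph) (X : {set edge G}) : mgraph :=
  subgraph (\bigcup_(e in X) ends e) X.

Definition k_connected (k : nat) (G : mgraph) : Prop :=
  forall S : {set vert G}, #|S| < k -> connected (del_vertices S).

(* G / X: the vertices are the vertex sets of the components of the spanning
   subgraph with edge set X, and the edges are those outside X. *)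
Section Contraction.
Variables (G : mgraph) (X : {set edge G}).

Definition component (x : vert G) : {set vert G} :=
  [set y | connect (adj X) x y].

Definition components : {set {set vert G}} :=
  [set component x | x : vert G].

Definition contract_ends (e : {e : edge G | e \notin X}) :
    {set {B : {set vert G} | B \in components}} :=
  [set B | val B \in component @: ends (val e)].

Lemma card_contract_ends e : 0 < #|contract_ends e| <= 2.
Proof.
have <- : #|component @: ends (val e)| = #|contract_ends e|.
  rewrite -(card_imset (contract_ends e) val_inj); apply: eq_card => B.
  apply/idP/imsetP => [Be | [C]]; last by rewrite inE => Ce ->.
  have BP : B \in components.
    by case/imsetP: Be => x _ ->; apply: imset_f.
  by exists (Sub B BP); rewrite ?inE SubK.
have /andP[e_gt0 e_le2] := card_ends (val e).
rewrite (leq_trans (leq_imset_card _ _) e_le2) andbT.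
have [x xe] := card_gt0P e_gt0.
by apply/card_gt0P; exists (component x); apply: imset_f.
Qed.

Definition contract : mgraph := MGraph card_contract_ends.
End Contraction.

Definition has_minor (H G : mgraph) : Prop :=
  exists (W : {set vert G}) (D : {set edge G})
         (X : {set edge (subgraph W D)}),
    iso (contract X) H.

Definition contractible (H G : mgraph) (e : edge G) : Prop :=
  k_connected 3 (contract [set e]) /\ has_minor H (contract [set e]).

(* Edge sets of cycles, a cycle being a nonnull connected 2-regular graph. *)
Definition circuit (G : mgraph) (C : {set edge G}) : bool :=
  [&& C != set0, connected (edge_induced C) &
      [forall v : vert (edge_induced C), deg v == 2]].

Definition triangle (G : mgraph) (X : {set edge G}) : Prop :=
  circuit X /\ #|X| = 3.

Definition star_ends (n : nat) (i : 'I_n) : {set option 'I_n} :=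
  [set None; Some i].

Lemma card_star_ends n (i : 'I_n) : 0 < #|star_ends i| <= 2.
Proof. by rewrite cards2. Qed.

Definition star (n : nat) : mgraph := MGraph (@card_star_ends n).

Definition wye (G : mgraph) (X : {set edge G}) : Prop :=
  iso (edge_induced X) (star 3) /\
  exists2 v : vert G, deg v = 3 & X = edges_at v.

Definition fan_ordering (G : mgraph) (X : {set edge G}) (s : seq (edge G)) :
    Prop :=
  [/\ uniq s, X = [set:: s],
      forall a b c, infix [:: a; b; c] s ->
        wye [set a; b; c] \/ triangle [set a; b; c]
    & forall a b c d, infix [:: a; b; c; d] s ->
        wye [set a; b; c] <-> triangle [set b; c; d]].

(* Fans are identified with their edge sets. *)
Definition fan (G : mgraph) (X : {set edge G}) : Prop :=
  [/\ simple (edge_induced X), 3 <= #|X| & exists s, fan_ordering X s].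

Definition wye_to_wye_ordering (G : mgraph) (X : {set edge G})
    (s : seq (edge G)) : Prop :=
  [/\ fan_ordering X s, wye [set:: take 3 s] &
      wye [set:: drop (size s - 3) s]].

Definition wye_to_wye_fan (G : mgraph) (X : {set edge G}) : Prop :=
  fan X /\ exists s, wye_to_wye_ordering X s.

Definition maximal_wye_to_wye_fan (G : mgraph) (X : {set edge G}) : Prop :=
  wye_to_wye_fan X /\
  forall Y : {set edge G}, wye_to_wye_fan Y -> ~~ (X \proper Y).

(* If x_0, y_1, x_1, ..., y_n, x_n is a wye-to-wye ordering, then t below is
   y_1, x_1, ..., x_(n-1), y_n; for n = 1 it is the single edge y_1. *)
Definition inner_fan (H G : mgraph) (F : {set edge G}) : Prop :=
  exists (X : {set edge G}) (x0 xn : edge G) (t : seq (edge G)),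
    [/\ maximal_wye_to_wye_fan X,
        wye_to_wye_ordering X (x0 :: rcons t xn),
        F = [set:: t],
        k_connected 3 (contract F)
      & has_minor H (contract F)].

Definition forest (G : mgraph) (F : {set edge G}) : bool :=
  [forall C : {set edge G}, (C \subset F) ==> ~~ circuit C].

Definition spanning_forest (G : mgraph) (X F : {set edge G}) : bool :=
  maxset (fun D : {set edge G} => (D \subset X) && forest D) F.

(* All spanning forests of G[X] have the same number of edges; the maximum
   selects this common value. *)
Definition rank (G : mgraph) (X : {set edge G}) : nat :=
  \max_(F : {set edge G} | spanning_forest X F) #|F|.

Definition free_family (G : mgraph) (FF : {set {set edge G}}) : Prop :=
  trivIset FF /\
  forall C : {set edge G}, circuit C -> C \subset cover FF ->
    exists2 X, X \in FF & C \subset X.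

Definition fan_family (H G : mgraph) (FF : {set {set edge G}}) : Prop :=
  trivIset FF /\
  forall X, X \in FF ->
    inner_fan H X \/ exists2 e : edge G, X = [set e] & contractible H e.

(* Main.v *)
Require Import Defs.
From mathcomp Require Import all_boot zify.

(* If a vertex v of degree 3 lies on a triangle T, the edge e at v outside T can
   be contracted: paths through v are rerouted along the opposite edge of T, so
   G/e is 3-connected, and G/e has every simple minor of G/T.

   For n >= 3 this makes the n-1 edges x_1, ..., x_(n-1) of an inner fan of rank
   n contractible, and 2(n-1) > n.  For n = 2 the inner fan is a triangle with
   two cubic vertices, whose outer edges are contractible; either a third
   contractible edge lies in the triangle, or its last vertex is cubic as well.

   Let B be the set of triangles in the family with three cubic vertices, W
   their vertex set and O the set of edges leaving them.  Each edge of O has an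
   end in W that no other selected edge meets, so O extends the forest selected
   in the other members.  If B is nonempty, the singletons of the family with
   both ends in W, together with two edges from each triangle of B, form a
   forest on W, hence number less than |W| <= |O| + |O2|, where O2 consists of
   the edges of O with both ends in W; this yields the required count.  If B is
   empty and each member is a triangle that gives just one edge, replace this
   edge in one of them by its two contractible outer edges. *)

Set Implicit Arguments.
Unset Strict Implicit.
Unset Printing Implicit Defensive.


(** * Walks and adjacency in subgraphs *)

Lemma connect_homo (T T' : finType) (e : rel T) (e' : rel T') (f : T -> T') :
    (forall x y, e x y -> connect e' (f x) (f y)) ->
  forall x y, connect e x y -> connect e' (f x) (f y).
Proof.
move=> fP x y /connectP[p]; elim: p x => [|z p IHp] x /=; first by move=> _ ->.
by case/andP=> /fP xz pz lp; apply: connect_trans xz (IHp _ pz lp).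
Qed.

Lemma adjP (G : mgraph) (X : {set edge G}) x y :
  reflect (exists2 e, e \in X & ends e = [set x; y]) (adj X x y).
Proof.
apply: (iffP existsP) => [[e /andP[eX /eqP eE]]|[e eX eE]]; first by exists e.
by exists e; rewrite eX eE eqxx.
Qed.

Lemma adj_sym (G : mgraph) (X : {set edge G}) : symmetric (adj X).
Proof. by move=> x y; apply/eq_existsb => e; rewrite setUC. Qed.

Lemma connect_adj_sym (G : mgraph) (X : {set edge G}) :
  connect_sym (adj X).
Proof. by apply: sym_connect_sym; apply: adj_sym. Qed.

Lemma val_subgraph_ends (G : mgraph) (W : {set vert G}) (D : {set edge G})
    (e : edge (subgraph W D)) : val @: ends e = ends (val e).
Proof.
apply/setP => x; apply/imsetP/idP => [[y]|xe]; first by rewrite inE => ye ->.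
have /andP[_ /subsetP/(_ x xe) xW] := valP e.
by exists (Sub x xW); rewrite ?inE SubK.
Qed.

Lemma subgraph_ends2 (G : mgraph) (W : {set vert G}) (D : {set edge G})
    (e : edge (subgraph W D)) (x y : vert (subgraph W D)) :
  (ends e == [set x; y]) = (ends (val e) == [set val x; val y]).
Proof.
have -> : [set val x; val y] = val @: [set x; y] by rewrite imsetU !imset_set1.
by rewrite -val_subgraph_ends (inj_eq (imset_inj val_inj)).
Qed.

Lemma adj_subgraph (G : mgraph) (W : {set vert G}) (D : {set edge G})
    (x y : vert (subgraph W D)) :
  adj [set: edge (subgraph W D)] x y = adj D (val x) (val y).
Proof.
apply/adjP/adjP => [[e _ /eqP]|[e eD eE]].
  by rewrite subgraph_ends2 => /eqP eE; exists (val e) => //; case/andP: (valP e).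
have eP : (e \in D) && (ends e \subset W).
  by rewrite eD eE subUset !sub1set (valP x) (valP y).
by exists (Sub e eP) => //; apply/eqP; rewrite subgraph_ends2 SubK eE.
Qed.

(** * Connectivity of vertex-deleted graphs and of contractions *)

Section Offset.
Variable G : mgraph.
Implicit Types (S : {set vert G}) (x y : vert G).

(** Steps of walks in [G - S], kept on the vertex type of [G] so that walks for different [S] can be
    compared. *)
Definition adj_off S : rel (vert G) :=
  fun x y => [&& x \notin S, y \notin S & adj [set: edge G] x y].

Definition connected_off S : Prop :=
  forall x y, x \notin S -> y \notin S -> connect (adj_off S) x y.

Lemma adj_off_sym S : symmetric (adj_off S).
Proof. by move=> x y; rewrite /adj_off adj_sym andbCA. Qed.

Lemma connect_off_sym S : connect_sym (adj_off S).
Proof. by apply: sym_connect_sym; apply: adj_off_sym. Qed.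

Lemma connect_off_notin S x y :
  connect (adj_off S) x y -> x \notin S -> y \notin S.
Proof.
move=> /connectP[p]; elim: p x => [|z p IHp] x /=; first by move=> _ ->.
by move=> /andP[/and3P[_ zS _] pz] lp _; apply: IHp pz lp zS.
Qed.

Lemma connected_offP S : connected (del_vertices S) <-> connected_off S.
Proof.
split=> [conn x y xS yS | conn].
  rewrite -in_setC in xS; rewrite -in_setC in yS.
  have /forallP/(_ (Sub x xS))/forallP/(_ (Sub y yS)) := conn.
  have homo (a b : vert (del_vertices S)) :
      adj [set: edge (del_vertices S)] a b ->
      connect (adj_off S) (val a) (val b).
    rewrite adj_subgraph => ab; apply: connect1; rewrite /adj_off ab.
    by have := valP a; have := valP b; rewrite !inE => -> ->.
  by move/(connect_homo homo); rewrite !SubK.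
apply/forallP => x; apply/forallP => y.
have xS := valP x; have yS := valP y; rewrite /= !inE in xS yS.
have homo a b : adj_off S a b ->
    connect (adj [set: edge (del_vertices S)])
      (insubd x a) (insubd x b).
  move=> /and3P[aS bS ab]; apply: connect1.
  by rewrite adj_subgraph !insubdK ?inE.
by have := connect_homo homo (conn _ _ xS yS); rewrite !valKd.
Qed.

Lemma k_connected_off k : k_connected k G ->
  forall S, #|S| < k -> connected_off S.
Proof. by move=> Gk S /Gk/connected_offP. Qed.

End Offset.

Section ContractVertices.
Variables (G : mgraph) (X : {set edge G}).

Definition cvert (x : vert G) : vert (contract X) :=
  exist _ (component X x) (imset_f _ (isT : x \in vert G)).

Lemma cvert_surj (c : vert (contract X)) : exists x, c = cvert x.
Proof. by case/imsetP: (valP c) => x _ cE; exists x; apply: val_inj. Qed.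

Lemma cvert_eq x y : (cvert x == cvert y) = connect (adj X) x y.
Proof.
apply/eqP/idP => [[E]|xy].
  by have : y \in component X x; [rewrite E inE | rewrite inE].
apply: val_inj; apply/setP => z; rewrite !inE.
exact: (same_connect (@connect_adj_sym G X)).
Qed.

Lemma cvert_ends (e : edge (contract X)) : ends e = cvert @: ends (val e).
Proof.
apply/setP => B; rewrite inE; apply/imsetP/imsetP => [] [x xe E]; exists x => //.
  exact: val_inj.
by rewrite E.
Qed.

End ContractVertices.

(** Walks off the preimage of [S] project to walks off [S]: an edge of [X] collapses to a vertex,
    any other edge survives. *)
Lemma connected_off_contract (G : mgraph) (X : {set edge G})
    (S : {set vert (contract X)}) :
  connected_off (cvert X @^-1: S) -> connected_off S.
Proof.
move=> conn c d; have [x ->] := cvert_surj c; have [y ->] := cvert_surj d.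
move=> xS yS; move: (conn x y); rewrite !inE => /(_ xS yS).
apply: connect_homo => {x y xS yS} x y /and3P[]; rewrite !inE => xS yS.
case/adjP=> e _ eE; case: (boolP (e \in X)) => eX.
  have /eqP -> : cvert X x == cvert X y by rewrite cvert_eq connect1 //; apply/adjP; exists e.
  exact: connect0.
apply: connect1; rewrite /adj_off xS yS; apply/adjP; exists (Sub e eX) => //.
by rewrite cvert_ends SubK eE imsetU !imset_set1.
Qed.

Lemma connect_adj1 (G : mgraph) (e : edge G) v z x y : ends e = [set v; z] ->
  connect (adj [set e]) x y -> x = y \/ (x \in ends e /\ y \in ends e).
Proof.
move=> eE /connectP[p]; elim: p x => [|w p IHp] x /=; first by left.
case/andP=> /adjP[_ /set1P -> E] pw lw; rewrite E !inE eqxx.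
by case: (IHp _ pw lw) => [<- | [_]]; rewrite ?E ?inE ?eqxx ?orbT; right.
Qed.

(** If [S] avoids the contracted vertex, its preimage is no larger and the 3-connectedness of [G]
    applies. Otherwise the preimage contains both [v] and [z], and without [v] it is no larger than
    [S]; this is the case left to the last hypothesis. *)
Lemma contract1_3connected (G : mgraph) (e : edge G) v z :
    k_connected 3 G -> ends e = [set v; z] ->
    (forall S : {set vert G}, v \in S -> z \in S -> #|S :\ v| < 3 ->
       connected_off S) ->
  k_connected 3 (contract [set e]).
Proof.
move=> G3 eE cut S S3; apply/connected_offP/connected_off_contract.
set P := _ @^-1: S.
have vz : cvert [set e] v = cvert [set e] z.
  by apply/eqP; rewrite cvert_eq connect1 //; apply/adjP; exists e; rewrite ?inE.
have inj : {in ~: [set v] &, injective (cvert [set e])}.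
  move=> x y; rewrite !inE => xv yv /eqP; rewrite cvert_eq.
  case/(connect_adj1 eE) => [// | []]; rewrite eE !inE (negbTE xv) (negbTE yv) /=.
  by move=> /eqP -> /eqP ->.
have PS : #|P :\ v| <= #|S|.
  rewrite -(card_in_imset (f := cvert [set e]) (D := P :\ v)).
    apply/subset_leq_card/subsetP => _ /imsetP[x xP ->].
    by move: xP; rewrite !inE => /andP[].
  by apply: sub_in2 inj => x; rewrite !inE => /andP[].
have [vP | vP] := boolP (v \in P).
  by apply: cut => //; [move: vP; rewrite !inE vz | apply: leq_ltn_trans PS S3].
apply: (k_connected_off G3); apply: leq_ltn_trans S3.
apply: leq_trans PS; apply/subset_leq_card/subsetP => x xP; rewrite in_setD1 xP andbT.
by apply: contraNneq vP => <-.
Qed.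

(** * Minors as branch sets *)

Section MinorModel.
Variables H K : mgraph.
Implicit Types (phi : vert K -> option (vert H)) (psi : edge H -> edge K).

Definition fiber_adj phi : rel (vert K) :=
  fun x y => (phi x == phi y) && adj [set: edge K] x y.

(* The fibers of [phi] over [Some h] are the branch sets; the deleted vertices
   are sent to [None]. *)
Definition minor_model phi psi : Prop :=
  [/\ injective psi,
      forall h, exists x, phi x = Some h,
      forall x y, phi x = phi y -> phi x -> connect (fiber_adj phi) x y
    & forall e, phi @: ends (psi e) = Some @: ends e].

Lemma has_minor_model : has_minor H K -> exists phi psi, minor_model phi psi.
Proof.
case=> W [D] [X] [f] [g] [fbij [g' gK g'K] fg].
pose phi x := omap (fun w => f (cvert X w)) (insub x : option (vert (subgraph W D))).
have phi_val w : phi (val w) = Some (f (cvert X w)) by rewrite /phi valK.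
exists phi, (fun h => val (val (g' h))); split.
- by apply: inj_comp val_inj (inj_comp val_inj (can_inj g'K)).
- move=> h; have [f' fK f'K] := fbij; have [w E] := cvert_surj (f' h).
  by exists (val w); rewrite phi_val -E f'K.
- move=> x y; rewrite {1 2 3}/phi.
  case: insubP => // w _ <- /=; case: insubP => // w' _ <- /= [/(bij_inj fbij)/eqP].
  rewrite cvert_eq => ww' _; apply: connect_homo ww' => a b ab; apply: connect1.
  rewrite /fiber_adj !phi_val; apply/andP; split.
    by have /eqP -> : cvert X a == cvert X b by rewrite cvert_eq connect1.
  by case/adjP: ab => e _ /eqP; rewrite subgraph_ends2 => /eqP E; apply/adjP; exists (val e).
- move=> h; rewrite -{2}(g'K h) fg cvert_ends -val_subgraph_ends -!imset_comp.
  by apply: eq_imset => w /=; rewrite phi_val.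
Qed.

(** Keep the vertices of the branch sets, the edges [psi h] and all edges inside a branch set, and
    contract the latter. As edges of [H] have two ends, no [psi h] lies inside a branch set, so
    exactly the edges [psi h] survive. *)
Lemma model_has_minor phi psi :
  (forall e : edge H, #|ends e| = 2) -> minor_model phi psi -> has_minor H K.
Proof.
move=> H2 [psi_inj phi_surj phi_conn phi_ends].
pose inner e := [forall x in ends e, forall y in ends e, phi x == phi y].
have psi_inner h : ~~ inner (psi h).
  apply/negP => /'forall_in_forall_inP eq_phi.
  have : 1 < #|phi @: ends (psi h)| by rewrite phi_ends card_imset ?H2 //; apply: Some_inj.
  case/card_gt1P => _ [_] [/imsetP[x xe ->] /imsetP[y ye ->]].
  by rewrite (eqP (eq_phi _ xe _ ye)) eqxx.
pose W := [set x | isSome (phi x)].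
pose D := psi @: [set: edge H] :|: [set e | inner e].
pose K' := subgraph W D.
pose X := [set e : edge K' | inner (val e)].
have phiW (w : vert K') : exists h, phi (val w) == Some h.
  by have := valP w; rewrite inE; case: (phi _) => // h _; exists h.
pose f0 w := xchoose (phiW w).
have f0E w : phi (val w) = Some (f0 w) by apply/eqP/(xchooseP (phiW w)).
have adjX (a b : vert K') : adj X a b = fiber_adj phi (val a) (val b).
  apply/adjP/andP => [[e eX /eqP eE]|[/eqP ab /adjP[e _ eE]]].
    rewrite subgraph_ends2 in eE; have {}eE := eqP eE; split; last by apply/adjP; exists (val e).
    move: eX; rewrite inE => /'forall_in_forall_inP -> //; rewrite eE !inE eqxx ?orbT //.
  have ei : inner e.
    by apply/'forall_in_forall_inP => x; rewrite eE => /set2P[] -> y /set2P[] ->; rewrite ?ab.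
  have eP : (e \in D) && (ends e \subset W).
    by rewrite !inE ei orbT eE subUset !sub1set (valP a) (valP b).
  exists (Sub e eP); first by rewrite inE SubK.
  by apply/eqP; rewrite subgraph_ends2 SubK eE.
have connX (a b : vert K') : connect (adj X) a b = (phi (val a) == phi (val b)).
  apply/idP/eqP => [/connectP[p]|ab].
    elim: p a => [|c p IHp] a /=; first by move=> _ ->.
    by rewrite adjX => /andP[/andP[/eqP -> _]]; apply: IHp.
  (* A step inside a fiber has both ends in [W] or both outside; in the second case both go to the
     default value [a]. *)
  have homo x y : fiber_adj phi x y -> connect (adj X) (insubd a x) (insubd a y).
    move=> xy; case/andP: (xy) => /eqP Exy _; case xW: (x \in W).
      have yW : y \in W by move: xW; rewrite !inE Exy.
      by apply: connect1; rewrite adjX !insubdK.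
    have yW : y \in W = false by move: xW; rewrite !inE Exy.
    by rewrite /insubd !insubF.
  have := connect_homo homo (phi_conn _ _ ab _); rewrite f0E => /(_ isT).
  by rewrite !valKd.
have repP (c : vert (contract X)) : exists w, c == cvert X w.
  by have [w ->] := cvert_surj c; exists w.
pose rep c := xchoose (repP c).
have repK c : cvert X (rep c) = c by apply/esym/eqP/(xchooseP (repP c)).
pose f c := f0 (rep c).
have f_cvert w : f (cvert X w) = f0 w.
  apply: Some_inj; rewrite -!f0E; apply/eqP.
  by rewrite -connX -cvert_eq repK.
have psiD h : (psi h \in D) && (ends (psi h) \subset W).
  rewrite inE imset_f //=; apply/subsetP => x xe; rewrite inE.
  have : phi x \in Some @: ends h by rewrite -phi_ends imset_f.
  by case/imsetP => ? _ ->.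
pose psi' h : edge K' := Sub (psi h) (psiD h).
have psiX h : psi' h \notin X by rewrite inE SubK.
pose g' h : edge (contract X) := Sub (psi' h) (psiX h).
have g'_surj e : exists h, e == g' h.
  have /andP[] := valP (val e); rewrite inE => /orP[/imsetP[h _ E] _|].
    by exists h; apply/eqP/val_inj/val_inj.
  by have := valP e; rewrite !inE => /negbTE ->.
have g'_inj : injective g'.
  by move=> h h' /(congr1 val)/(congr1 val)/= /psi_inj.
pose g e := xchoose (g'_surj e).
have gK : cancel g g' by move=> e; apply/esym/eqP/(xchooseP (g'_surj e)).
exists W, D, X, f, g; split.
- have f_inj : injective f.
    move=> c d; rewrite -(repK c) -(repK d) !f_cvert => E.
    by apply/eqP; rewrite cvert_eq connX !f0E E.
  apply: inj_card_bij => //; rewrite -(card_codom f_inj).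
  apply/subset_leq_card/subsetP => h _; have [x xh] := phi_surj h.
  have xW : x \in W by rewrite inE xh.
  apply/codomP; exists (cvert X (Sub x xW)).
  by rewrite f_cvert; apply: Some_inj; rewrite -f0E SubK xh.
- by exists g' => // h; apply: g'_inj; rewrite gK.
- move=> e; set h := g e; rewrite -(gK e) -/h.
  apply: (imset_inj Some_inj); rewrite -phi_ends cvert_ends.
  have -> : ends (psi h) = val @: ends (psi' h) by rewrite val_subgraph_ends.
  by rewrite -!imset_comp; apply: eq_imset => w /=; rewrite f_cvert f0E.
Qed.
End MinorModel.


Lemma cards3 (T : finType) (a b c : T) : uniq [:: a; b; c] -> #|[set a; b; c]| = 3.
Proof.
rewrite /= !inE negb_or => /and3P[/andP[ab ac] bc _].
by rewrite -setUA cardsU1 cards2 !inE negb_or ab ac bc.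
Qed.

Lemma ends_set2 (G : mgraph) (e : edge G) x y :
  x \in ends e -> y \in ends e -> x != y -> ends e = [set x; y].
Proof.
move=> xe ye xy; apply/esym/eqP; rewrite eqEcard subUset !sub1set xe ye cards2 xy.
by case/andP: (card_ends e).
Qed.

(** Composition with [cvert F] pulls a model back to [G]; conversely, a map that is constant on each
    edge of [F] is constant on the components of [F] and descends. Contractions of different edge
    sets thus become comparable as models in the same graph [G]. *)
Lemma contract_minorP (H G : mgraph) (F : {set edge G}) :
    (forall h : edge H, #|ends h| = 2) ->
  has_minor H (contract F) <->
  exists (phi : vert G -> option (vert H)) (psi : edge H -> edge G),
    minor_model phi psi /\
    (forall e, e \in F -> {in ends e &, forall x y, phi x = phi y}).
Proof.
move=> H2; split=> [/has_minor_model[phi [psi [psi_inj phi_surj phi_conn phi_ends]]]|].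
  have adjF x y : adj F x y -> fiber_adj (phi \o cvert F) x y.
    move=> xy; apply/andP; split.
      by have /eqP /= -> : cvert F x == cvert F y by rewrite cvert_eq connect1.
    by case/adjP: xy => e _ E; apply/adjP; exists e.
  have cvertF x y : cvert F x = cvert F y -> connect (fiber_adj (phi \o cvert F)) x y.
    move/eqP; rewrite cvert_eq; apply: connect_sub => a b /adjF; exact: connect1.
  exists (phi \o cvert F), (fun h => val (psi h)); split; last first.
    move=> e eF x y xe ye /=; congr phi; apply/eqP; rewrite cvert_eq.
    have [->|xy] := eqVneq x y; first exact: connect0.
    by apply/connect1/adjP; exists e => //; apply: ends_set2.
  split.
  - exact: inj_comp val_inj psi_inj.
  - move=> h; have [c hc] := phi_surj h; have [x E] := cvert_surj c.
    by exists x; rewrite /= -E.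
  - move=> x y /= Exy hx; have /connectP[p] := phi_conn _ _ Exy hx.
    (* The path lives in [G/F]. Each step is lifted to an edge of [G], and consecutive lifts are
       joined inside a component of [F]. *)
    move: (erefl (cvert F x)); move: {1 3 4}(cvert F x) => c.
    elim: p c x {Exy hx} => [|d p IHp] c x /= cE; first by move=> _ E; apply: cvertF; rewrite -cE.
    case/andP=> /andP[/eqP cd /adjP[e _ eE]] dp lp.
    have /imsetP[a ae ac] : c \in cvert F @: ends (val e).
      by rewrite -cvert_ends eE !inE eqxx.
    have /imsetP[b be bd] : d \in cvert F @: ends (val e).
      by rewrite -cvert_ends eE !inE eqxx orbT.
    have xa : connect (fiber_adj (phi \o cvert F)) x a by apply: cvertF; rewrite -cE.
    apply: connect_trans xa (connect_trans _ (IHp d b bd dp lp)).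
    have [->|ab] := eqVneq a b; first exact: connect0.
    apply: connect1; rewrite /fiber_adj /= -ac -bd cd eqxx.
    by apply/adjP; exists (val e) => //; apply: ends_set2.
  - by move=> e; rewrite -phi_ends cvert_ends -imset_comp.
case=> phi [psi [[psi_inj phi_surj phi_conn phi_ends] phiF]].
have phi_cvert x y : cvert F x = cvert F y -> phi x = phi y.
  move/eqP; rewrite cvert_eq => /connectP[p]; elim: p x => [|z p IHp] x /=; first by move=> _ ->.
  case/andP=> /adjP[e eF eE] zp lp; rewrite -(IHp z zp lp).
  by apply: (phiF e eF); rewrite eE !inE eqxx ?orbT.
have repP (c : vert (contract F)) : exists x, c == cvert F x.
  by have [w ->] := cvert_surj c; exists w.
pose rep c := xchoose (repP c).
have repK c : cvert F (rep c) = c by apply/esym/eqP/(xchooseP (repP c)).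
have phi_rep x : phi (rep (cvert F x)) = phi x by apply: phi_cvert; rewrite repK.
have psiF h : psi h \notin F.
  apply/negP => /phiF E.
  have : 1 < #|phi @: ends (psi h)| by rewrite phi_ends card_imset ?H2 //; apply: Some_inj.
  case/card_gt1P => _ [_] [/imsetP[x xe ->] /imsetP[y ye ->]].
  by rewrite (E _ _ xe ye) eqxx.
apply: (@model_has_minor _ _ (phi \o rep) (fun h => Sub (psi h) (psiF h))) => //; split.
- by move=> h h' /(congr1 val)/= /psi_inj.
- by move=> h; have [x xh] := phi_surj h; exists (cvert F x); rewrite /= phi_rep.
- move=> c d /= cd hc; have := phi_conn _ _ cd hc.
  rewrite -{2}(repK c) -{2}(repK d); apply: connect_homo => x y /andP[/eqP xy].
  case/adjP=> e _ eE; case: (boolP (e \in F)) => eF.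
    have /eqP -> : cvert F x == cvert F y by rewrite cvert_eq connect1 //; apply/adjP; exists e.
    exact: connect0.
  apply: connect1; rewrite /fiber_adj /= !phi_rep xy eqxx; apply/adjP; exists (Sub e eF) => //.
  by rewrite cvert_ends SubK eE imsetU !imset_set1.
- move=> h; rewrite -phi_ends cvert_ends SubK -imset_comp.
  by apply: eq_imset => x /=; rewrite phi_rep.
Qed.

Lemma contract_minor_mem (H G : mgraph) (F : {set edge G}) e :
    (forall h : edge H, #|ends h| = 2) -> e \in F ->
  has_minor H (contract F) -> has_minor H (contract [set e]).
Proof.
move=> H2 eF /contract_minorP[] // phi [psi [mod phiF]]; apply/contract_minorP => //.
by exists phi, psi; split=> // _ /set1P ->; apply: phiF.
Qed.

(** * Triangles and cubic vertices *)

Section Simple.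
Variable G : mgraph.
Hypothesis G_simple : simple G.
Implicit Types (C D T : {set edge G}) (e : edge G) (v : vert G).

Definition inc C v := edges_at v :&: C.
Definition verts C := \bigcup_(e in C) ends e.

Lemma in_inc C v e : (e \in inc C v) = (v \in ends e) && (e \in C).
Proof. by rewrite !inE. Qed.

Lemma vertsP C v : reflect (exists2 e, e \in C & v \in ends e) (v \in verts C).
Proof. exact: bigcupP. Qed.

Lemma ends_inj e e' : ends e = ends e' -> e = e'.
Proof. by case: G_simple => _; apply. Qed.

Lemma other_end e v : v \in ends e -> exists2 w, w != v & ends e = [set v; w].
Proof.
case: G_simple => /(_ e)/eqP/cards2P[x [y [xy E]]] _; rewrite E => /set2P[]->.
  by exists y; rewrite // eq_sym.
by exists x; rewrite // setUC.
Qed.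

Lemma ends_neq e v w : ends e = [set v; w] -> v != w.
Proof.
by move=> E; case: G_simple => /(_ e); rewrite E cards2; case: (v != w).
Qed.

Lemma deg_simple v : deg v = #|edges_at v|.
Proof.
rewrite /deg; set B := [set e in _ | _]; have -> : B = set0.
  by apply/setP => e; rewrite !inE; case: G_simple => ->; rewrite andbF.
by rewrite cards0 addn0.
Qed.

Lemma edge_induced_deg C (v : vert (edge_induced C)) : deg v = #|inc C (val v)|.
Proof.
rewrite /deg; set B := [set e in _ | _]; have -> : B = set0.
  apply/setP => e; rewrite !inE -(card_imset _ val_inj) val_subgraph_ends.
  by case: G_simple => ->; rewrite andbF.
rewrite cards0 addn0 -(card_imset _ val_inj); apply: eq_card => e; rewrite in_inc.
apply/imsetP/andP => [[e']|[ve eC]].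
  by rewrite inE inE => ve ->; split=> //; case/andP: (valP e').
have eP : (e \in C) && (ends e \subset verts C) by rewrite eC bigcup_sup.
by exists (Sub e eP); rewrite ?inE SubK.
Qed.

Lemma circuit_deg C v : circuit C -> v \in verts C -> #|inc C v| = 2.
Proof.
by case/and3P=> _ _ /forallP deg2 vC; have /eqP := deg2 (Sub v vC); rewrite edge_induced_deg.
Qed.

Lemma circuit_neq0 C : circuit C -> C != set0.
Proof. by case/and3P. Qed.

Lemma circuit_other C e v : circuit C -> e \in C -> v \in ends e ->
  exists e', [/\ e' \in C, e' != e & v \in ends e'].
Proof.
move=> Cc eC ve; have /(circuit_deg Cc) d2 : v \in verts C by apply/vertsP; exists e.
have /card_gt0P[e'] : 0 < #|inc C v :\ e|.
  by have := cardsD1 e (inc C v); rewrite d2 in_inc ve eC add1n => -[<-].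
by rewrite in_setD1 in_inc => /and3P[e'e ve' e'C]; exists e'.
Qed.

(** From [v] the circuit continues along [e1] to [p] and along [e2] to [q]; as there are only three
    edges, the second edges at [p] and at [q] coincide. *)
Lemma triangle_at T v : triangle T -> v \in verts T ->
  exists p q e1 e2 e3, [/\ T = [set e1; e2; e3], uniq [:: e1; e2; e3],
    ends e1 = [set v; p], ends e2 = [set v; q] & ends e3 = [set p; q]].
Proof.
case=> Tc T3 /vertsP[e1 e1T ve1]; have [p _ E1] := other_end ve1.
have [e2 [e2T e21 ve2]] := circuit_other Tc e1T ve1; have [q qv E2] := other_end ve2.
have pq : p != q by apply: contraNneq e21 => pq; apply/eqP/ends_inj; rewrite E1 E2 pq.
have pe1 : p \in ends e1 by rewrite E1 !inE eqxx orbT.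
have qe2 : q \in ends e2 by rewrite E2 !inE eqxx orbT.
have [e3 [e3T e31 pe3]] := circuit_other Tc e1T pe1.
have e32 : e3 != e2.
  apply: contraTneq pe3 => ->; rewrite E2 !inE negb_or pq andbT eq_sym.
  exact: ends_neq E1.
have Uniq : uniq [:: e1; e2; e3] by rewrite /= !inE negb_or eq_sym e21 eq_sym e31 eq_sym e32.
have TE : T = [set e1; e2; e3].
  apply/esym/eqP; rewrite eqEcard T3 !subUset !sub1set e1T e2T e3T /=.
  by rewrite cards3.
have [e4 [e4T e42 qe4]] := circuit_other Tc e2T qe2.
have qe3 : q \in ends e3.
  move: e4T; rewrite TE !inE (negbTE e42) orbF => /orP[]/eqP E4; last by rewrite -E4.
  by move: qe4; rewrite E4 E1 !inE (negbTE qv) eq_sym (negbTE pq).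
by exists p, q, e1, e2, e3; split=> //; apply: ends_set2.
Qed.

Lemma card_triangle_verts T : triangle T -> #|verts T| = 3.
Proof.
move=> Tt; have /set0Pn[e eT] := circuit_neq0 (proj1 Tt).
have /card_gt0P[v ve] : 0 < #|ends e| by case/andP: (card_ends e).
have /(triangle_at Tt)[p [q [e1 [e2 [e3 [-> _ E1 E2 E3]]]]]] : v \in verts T by apply/vertsP; exists e.
rewrite /verts !bigcup_setU !big_set1 E1 E2 E3.
have := ends_neq E1; have := ends_neq E2; have := ends_neq E3 => pq vq vp.
have -> : [set v; p] :|: [set v; q] :|: [set p; q] = v |: [set p; q].
  by apply/setP => x; rewrite !inE; case: eqP; case: eqP; case: eqP.
by rewrite cardsU1 !inE negb_or vp vq cards2 pq.
Qed.

(* When [G] is simple, this forces [v] to have degree 3. *)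
Definition corner T v e :=
  [/\ triangle T, v \in verts T, e \notin T, v \in ends e
    & edges_at v \subset e |: T].

Lemma cornerP T v e : corner T v e ->
  exists z p q e1 e2 e3, [/\ ends e = [set v; z], ends e1 = [set v; p],
    ends e2 = [set v; q], ends e3 = [set p; q] &
    [/\ T = [set e1; e2; e3], z != p, z != q &
    forall f, v \in ends f -> [\/ f = e, f = e1 | f = e2]]].
Proof.
case=> Tt vT eT ve sub; have [z _ E] := other_end ve.
have [p [q [e1 [e2 [e3 [TE Uniq E1 E2 E3]]]]]] := triangle_at Tt vT.
exists z, p, q, e1, e2, e3; split=> //; split=> //.
- apply: contraNneq eT => zp; have -> : e = e1 by apply: ends_inj; rewrite E E1 zp.
  by rewrite TE !inE eqxx.
- apply: contraNneq eT => zq; have -> : e = e2 by apply: ends_inj; rewrite E E2 zq.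
  by rewrite TE !inE eqxx orbT.
move=> f vf; have : f \in e |: T by apply: (subsetP sub); rewrite inE.
rewrite TE !inE -!orbA => /or4P[]/eqP fE;
  [by constructor 1|by constructor 2|by constructor 3|].
by move: vf; rewrite fE E3 !inE (negbTE (ends_neq E1)) (negbTE (ends_neq E2)).
Qed.
End Simple.


(** Each passage of a walk through [v] is replaced by a detour through [w], from which all surviving
    neighbours of [v] can be reached. *)
Lemma reroute (G : mgraph) (S : {set vert G}) v w :
    connected_off (S :\ v) ->
    (forall b, b \notin S -> adj [set: edge G] v b -> connect (adj_off S) w b) ->
  connected_off S.
Proof.
move=> conn vw x y xS yS; have [vS | vS] := boolP (v \in S); last first.
  have SE : S :\ v = S by apply/setDidPl; rewrite disjoint_sym disjoints1.
  by rewrite -SE; apply: conn; rewrite SE.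
have off t : t \notin S -> t \notin S :\ v by apply: contra; rewrite in_setD1 => /andP[].
pose rho t := if t == v then w else t.
have step a b : adj_off (S :\ v) a b -> connect (adj_off S) (rho a) (rho b).
  move=> /and3P[]; rewrite !in_setD1 /rho.
  have [-> _|av /= aS] := eqVneq a v; have [-> _|bv /= bS] := eqVneq b v => ab.
  - exact: connect0.
  - exact: vw.
  - by rewrite connect_off_sym; apply: vw; rewrite // adj_sym.
  - by apply: connect1; apply/and3P.
have := connect_homo step (conn _ _ (off x xS) (off y yS)).
rewrite /rho; case: eqP => [xv|_]; first by rewrite -xv (negbTE xS) in vS.
by case: eqP => [yv|_] //; rewrite -yv (negbTE yS) in vS.
Qed.

(** * Contracting edges at a triangle *)

Section Corner.
Variable G : mgraph.
Hypotheses (G_simple : simple G) (G_3conn : k_connected 3 G).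
Implicit Types (T : {set edge G}) (e : edge G) (v : vert G).

Lemma set2_inr (a b c : vert G) : a != b -> [set a; b] = [set a; c] -> b = c.
Proof.
move=> ab E; have : b \in [set a; c] by rewrite -E !inE eqxx orbT.
by rewrite !inE eq_sym (negbTE ab) => /eqP.
Qed.

(** Once [z] is deleted, [v] has only the neighbours [p] and [q]. These are joined by [e3], so no
    walk needs [v]. *)
Lemma corner_3connected T v e : corner T v e -> k_connected 3 (contract [set e]).
Proof.
case/(cornerP G_simple) => z [p [q [e1 [e2 [e3 [E E1 E2 E3 [TE zp zq at_v]]]]]]].
have vz := ends_neq G_simple E; have vp := ends_neq G_simple E1.
have vq := ends_neq G_simple E2; have pq := ends_neq G_simple E3.
apply: (contract1_3connected G_3conn E) => S vS zS S3.
have nbr b : b \notin S -> adj [set: edge G] v b -> b = p \/ b = q.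
  move=> bS /adjP[f _ fE]; have vb := ends_neq G_simple fE.
  have vf : v \in ends f by rewrite fE !inE eqxx.
  case: (at_v f vf) => fe.
  - by move: bS; rewrite (set2_inr vb (c := z)) ?zS // -fE fe.
  - by left; apply: (set2_inr vb); rewrite -fE fe.
  - by right; apply: (set2_inr vb); rewrite -fE fe.
have conn := k_connected_off G_3conn S3.
have [pS | pS] := boolP (p \in S).
  apply: (reroute (w := q) conn) => b bS /(nbr b bS)[] bE; last by rewrite bE.
  by rewrite bE pS in bS.
apply: (reroute (w := p) conn) => b bS /(nbr b bS)[] bE; rewrite bE ?connect0 //.
rewrite bE in bS.
by apply: connect1; apply/and3P; split=> //; apply/adjP; exists e3.
Qed.

(* The branch set of the contracted triangle survives without [v], which moves
   to the branch set of the other end of [e]; the edge [vp] then replaces [e]. *)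
Lemma corner_minor (H : mgraph) T v e :
    (forall h : edge H, #|ends h| = 2) -> corner T v e ->
  has_minor H (contract T) -> has_minor H (contract [set e]).
Proof.
move=> H2 /(cornerP G_simple) [z [p [q [e1 [e2 [e3 [E E1 E2 E3 [TE zp zq at_v]]]]]]]].
have vz := ends_neq G_simple E; have vp := ends_neq G_simple E1.
have vq := ends_neq G_simple E2; have pq := ends_neq G_simple E3.
case/contract_minorP => // phi [psi [[psi_inj phi_surj phi_conn phi_ends] phiT]].
have phip : phi p = phi v by apply: (phiT e1); rewrite ?TE ?E1 !inE !eqxx ?orbT.
have phiq : phi q = phi v by apply: (phiT e2); rewrite ?TE ?E2 !inE !eqxx ?orbT.
have psi_out f : (forall x y, x \in ends f -> y \in ends f -> phi x = phi y) ->
    forall h, psi h != f.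
  move=> cf h; apply/eqP => hf.
  have : 1 < #|phi @: ends (psi h)| by rewrite phi_ends card_imset ?H2 //; apply: Some_inj.
  case/card_gt1P => _ [_] [/imsetP[x xe ->] /imsetP[y ye ->]].
  by rewrite (cf x y) ?eqxx -?hf.
apply/contract_minorP => //.
(* If [z] has the same image as the triangle, the given model is already constant on [e]. *)
have [zv | zv] := eqVneq (phi z) (phi v).
  exists phi, psi; split=> // _ /set1P -> x y; rewrite E.
  by move=> /set2P[] -> /set2P[] ->.
pose phi' x := if x == v then phi z else phi x.
pose psi' h := if psi h == e then e1 else psi h.
have phi'z : phi' z = phi z by rewrite /phi' eq_sym (negbTE vz).
have phi'v : phi' v = phi z by rewrite /phi' eqxx.
have phi'p : phi' p = phi v by rewrite /phi' eq_sym (negbTE vp).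
exists phi', psi'; split; last first.
  by move=> _ /set1P -> x y; rewrite E => /set2P[] -> /set2P[] ->; rewrite ?phi'z ?phi'v.
have psi1 h : psi h != e1.
  by apply: psi_out => x y; apply: phiT; rewrite TE !inE eqxx.
have psi2 h : psi h != e2.
  by apply: psi_out => x y; apply: phiT; rewrite TE !inE eqxx orbT.
split.
- move=> h h'; rewrite /psi'; case: eqP => [he|_]; case: eqP => [he'|_].
  + by move=> _; apply: psi_inj; rewrite he.
  + by move/eqP; rewrite eq_sym (negbTE (psi1 _)).
  + by move/eqP; rewrite (negbTE (psi1 _)).
  + exact: psi_inj.
- move=> h; have [x xh] := phi_surj h; have [xv|xv] := eqVneq x v.
    by exists p; rewrite phi'p -xv.
  by exists x; rewrite /phi' (negbTE xv).
(* On old paths [p] takes the place of [v]: inside its fiber [v] leads only to [p] and [q], which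
   [e3] joins. *)
- pose rho x := if x == v then p else x.
  have rhoP x : phi' (rho x) = phi x.
    by rewrite /rho; have [->|xv] := eqVneq x v; rewrite // /phi' (negbTE xv).
  have step_v b : fiber_adj phi v b -> connect (fiber_adj phi') p (rho b).
    case/andP=> /eqP vb /adjP[f _ fE]; have vb' := ends_neq G_simple fE.
    rewrite /rho eq_sym (negbTE vb').
    have vf : v \in ends f by rewrite fE !inE eqxx.
    case: (at_v f vf) => fe.
    + have bz : b = z by apply: (set2_inr vb'); rewrite -fE fe.
      by rewrite bz in vb; rewrite vb eqxx in zv.
    + have -> : b = p by apply: (set2_inr vb'); rewrite -fE fe.
      exact: connect0.
    + have -> : b = q by apply: (set2_inr vb'); rewrite -fE fe.
      apply: connect1; apply/andP; split; last by apply/adjP; exists e3.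
      by rewrite phi'p /phi' (eq_sym q) (negbTE vq) phiq.
  have step a b : fiber_adj phi a b -> connect (fiber_adj phi') (rho a) (rho b).
    have fs c d : fiber_adj phi c d = fiber_adj phi d c by rewrite /fiber_adj adj_sym eq_sym.
    have fs' : connect_sym (fiber_adj phi').
      by apply: sym_connect_sym => c d; rewrite /fiber_adj adj_sym eq_sym.
    have [->|av] := eqVneq a v; first by rewrite {1}/rho eqxx; apply: step_v.
    have [->|bv] := eqVneq b v; first by rewrite fs fs' {1}/rho eqxx; apply: step_v.
    case/andP=> ab ab'; apply: connect1; rewrite /fiber_adj !rhoP ab.
    by rewrite /rho (negbTE av) (negbTE bv).
  have vz' : connect (fiber_adj phi') v z.
    by apply: connect1; rewrite /fiber_adj phi'z phi'v eqxx; apply/adjP; exists e.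
  have fs' : connect_sym (fiber_adj phi').
    by apply: sym_connect_sym => c d; rewrite /fiber_adj adj_sym eq_sym.
  have rho_conn x y : phi x = phi y -> phi x -> connect (fiber_adj phi') (rho x) (rho y).
    by move=> xy hx; apply: connect_homo (phi_conn _ _ xy hx).
  have z_conn y : y != v -> phi z = phi y -> phi z -> connect (fiber_adj phi') z y.
    move=> yv zy hz; have := rho_conn _ _ zy hz.
    by rewrite /rho eq_sym (negbTE vz) (negbTE yv).
  move=> x y; rewrite /phi'; have [->|xv] := eqVneq x v; have [->|yv] := eqVneq y v.
  + by move=> *; apply: connect0.
  + by move=> zy hz; apply: connect_trans vz' _; apply: z_conn.
  + move=> xz hx; rewrite fs'; apply: connect_trans vz' _; apply: z_conn => //.
    by rewrite -xz.
  + by move=> xy hx; have := rho_conn _ _ xy hx; rewrite /rho (negbTE xv) (negbTE yv).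
- move=> h; rewrite -phi_ends /psi'; case: eqP => [he|/eqP he].
    by rewrite he E E1 !imsetU !imset_set1 phi'v phi'p setUC.
  (* An edge [psi h] at [v] other than [e] would be [e1] or [e2], but [phi] is constant on these. *)
  apply: eq_in_imset => x xe; rewrite /phi'; case: eqP => // xv; exfalso.
  rewrite xv in xe; case: (at_v _ xe) => /eqP; apply/negP => //.
Qed.

(** Let [u] be the third vertex of [T] and [g] the edge from [v] to [v']. If [u] has two edges
    outside [T], then contracting [g] keeps 3-connectedness; otherwise [u] has exactly one such edge
    and is a corner as well. *)
Lemma triangle_corners T v v' e e' : corner T v e -> corner T v' e' -> v != v' ->
  (exists2 g, g \in T & k_connected 3 (contract [set g])) \/
  (forall u, u \in verts T -> exists f, corner T u f).
Proof.
move=> c c' vv'; have [Tt vT eT ve at_v] := c; have [_ v'T e'T ve' at_v'] := c'.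
have [u [g [a [b [TE gE aE bE]]]]] : exists u g a b,
    [/\ T = [set g; a; b], ends g = [set v; v'], ends a = [set v; u] & ends b = [set v'; u]].
  have [p [q [e1 [e2 [e3 [TE _ E1 E2 E3]]]]]] := triangle_at G_simple Tt vT.
  have : v' \in [set p; q].
    have /vertsP[f] := v'T; rewrite TE !inE => /orP[/orP[]|] /eqP ->; rewrite ?E1 ?E2 ?E3 !inE //;
      by rewrite eq_sym (negbTE vv') /= => -> //; rewrite orbT.
  case/set2P=> ->; first by exists q, e1, e2, e3.
  exists p, e2, e1, e3; split=> //; last by rewrite setUC.
  by rewrite TE -!setUA (setUCA [set e1]).
have [vu v'u] := conj (ends_neq G_simple aE) (ends_neq G_simple bE).
have [z _ zE] := other_end G_simple ve; have [z' _ zE'] := other_end G_simple ve'.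
have inT f : ends f \in [:: ends g; ends a; ends b] -> f \in T.
  by rewrite TE !inE -orbA; case/or3P=> /eqP/(ends_inj G_simple) ->; rewrite eqxx ?orbT.
have zv' : z != v'.
  by apply: contraNneq eT => zv; apply: inT; rewrite zE zv gE !inE eqxx.
have zu : z != u.
  by apply: contraNneq eT => zv; apply: inT; rewrite zE zv aE !inE eqxx !orbT.
have zv : z' != v.
  by apply: contraNneq e'T => zv; apply: inT; rewrite zE' zv gE [[set v'; v]]setUC !inE eqxx.
have zu' : z' != u.
  by apply: contraNneq e'T => zv'0; apply: inT; rewrite zE' zv'0 bE !inE eqxx !orbT.
have nbr w : adj [set: edge G] v w -> [\/ w = z, w = v' | w = u].
  case/adjP=> f _ fE; have vw := ends_neq G_simple fE.
  have : f \in e |: T by apply: (subsetP at_v); rewrite inE fE !inE eqxx.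
  rewrite TE !inE -!orbA => /or4P[]/eqP fe.
  - by constructor 1; apply: (set2_inr vw); rewrite -fE fe.
  - by constructor 2; apply: (set2_inr vw); rewrite -fE fe.
  - by constructor 3; apply: (set2_inr vw); rewrite -fE fe.
  have : v \in ends b by rewrite -fe fE !inE eqxx.
  by rewrite bE !inE (negbTE vv') (negbTE vu).
have nbr' w : adj [set: edge G] v' w -> [\/ w = z', w = v | w = u].
  case/adjP=> f _ fE; have vw := ends_neq G_simple fE.
  have : f \in e' |: T by apply: (subsetP at_v'); rewrite inE fE !inE eqxx.
  rewrite TE !inE -!orbA => /or4P[]/eqP fe.
  - by constructor 1; apply: (set2_inr vw); rewrite -fE fe.
  - by constructor 2; apply: (set2_inr vw); rewrite -fE fe setUC.
  - have : v' \in ends a by rewrite -fe fE !inE eqxx.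
    by rewrite aE !inE eq_sym (negbTE vv') (negbTE v'u).
  - by constructor 3; apply: (set2_inr vw); rewrite -fE fe.
have [/existsP[f /existsP[f' /and5P[ff' fT fT' uf uf']]]|none] :=
  boolP [exists f, exists f', [&& f != f', f \notin T, f' \notin T, u \in ends f & u \in ends f']].
  left; exists g; first by rewrite TE !inE eqxx.
  apply: (contract1_3connected G_3conn gE) => S vS v'S S3.
  have S3' : #|S :\ v'| < 3.
    have := cardsD1 v S; rewrite (cardsD1 v' S) vS v'S => /eqP.
    by rewrite eqn_add2l => /eqP ->.
  have conn := k_connected_off G_3conn S3; have conn' := k_connected_off G_3conn S3'.
  have [uS | uS] := boolP (u \in S).
    apply: (reroute (w := z) conn) => w wS /nbr[] wE; rewrite wE ?connect0 //.
      by rewrite wE v'S in wS.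
    by rewrite wE uS in wS.
  (* [A] is the component of [u] off [S]. If [z] is deleted or lies in [A], walks through [v] can be
     rerouted through [u]; the same holds for [z'] and [v']. *)
  pose A := [set w | connect (adj_off S) u w].
  have AS w : w \in A -> w \notin S by rewrite inE => /connect_off_notin; apply.
  have [zA | zA] := boolP ((z \in S) || (z \in A)).
    apply: (reroute (w := u) conn) => w wS /nbr[] wE; rewrite wE ?connect0 //.
      by move: zA; rewrite -wE (negbTE wS) inE.
    by rewrite wE v'S in wS.
  have [zA' | zA'] := boolP ((z' \in S) || (z' \in A)).
    apply: (reroute (w := u) conn') => w wS /nbr'[] wE; rewrite wE ?connect0 //.
      by move: zA'; rewrite -wE (negbTE wS) inE.
    by rewrite wE vS in wS.
  exfalso; move: zA zA'; rewrite !negb_or => /andP[zS zA] /andP[zS' zA'].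
  (* [S] has at most one vertex besides [v] and [v'], while [f] and [f'] lead from [u] to two
     distinct vertices outside the triangle. *)
  have [w [wS uw]] : exists w, w \notin S /\ adj [set: edge G] u w.
    have [w wu wE] := other_end G_simple uf; have [w' wu' wE'] := other_end G_simple uf'.
    have [wS | wS] := boolP (w \in S); last by exists w; split=> //; apply/adjP; exists f.
    have [wS' | wS'] := boolP (w' \in S); last by exists w'; split=> //; apply/adjP; exists f'.
    have far h x : ends h = [set u; x] -> h \notin T -> x != v /\ x != v'.
      move=> hE hT; split; apply: contraNneq hT => xE; apply: inT;
      by rewrite hE xE setUC ?aE ?bE !inE eqxx ?orbT.
    have [wv wv'] := far _ _ wE fT; have [w'v w'v'] := far _ _ wE' fT'.
    have ww' : w != w'.
      by apply: contraNneq ff' => ww'; apply/eqP/(ends_inj G_simple); rewrite wE wE' ww'.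
    have : #|[set v'; w; w']| <= #|S :\ v|.
      apply/subset_leq_card; rewrite !subUset !sub1set !in_setD1 wS wS' v'S wv w'v.
      by rewrite eq_sym vv'.
    rewrite cards3; first by rewrite leqNgt S3.
    by rewrite /= !inE negb_or ww' (eq_sym v' w) wv' (eq_sym v' w') w'v'.
  (* Restore [v] and [v'] and delete [u] instead, which leaves at most two deleted vertices. A walk
     from [w] to [v] could leave [A] only by entering [v] or [v'] from [z] or [z'], and these are
     not in [A]. *)
  pose S' := u |: (S :\: [set v; v']).
  have S'3 : #|S'| < 3.
    have -> : S' = u |: (S :\ v :\ v') by apply/setP => x; rewrite !inE negb_or andbCA andbA.
    apply: leq_ltn_trans S3; rewrite (cardsD1 v' (S :\ v)) in_setD1 v'S eq_sym vv'.
    by rewrite cardsU1 leq_add2r leq_b1.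
  have wu : w != u.
    by case/adjP: uw => h _ /(ends_neq G_simple); rewrite eq_sym.
  have wS' : w \notin S' by rewrite !inE (negbTE wu) (negbTE wS) andbF.
  have vS' : v \notin S' by rewrite !inE eqxx (negbTE vu).
  have wA : w \in A by rewrite inE; apply: connect1; apply/and3P.
  have /connectP[p] := k_connected_off G_3conn S'3 wS' vS'.
  elim: p w wA {wS' uw wS} wu => [|x p IHp] w wA wu /=; first by move=> _ vw; move: (AS w wA); rewrite -vw vS.
  case/andP=> /and3P[wS' xS' wx] xp; apply: IHp xp; last first.
    by apply: contraNneq xS' => ->; rewrite !inE eqxx.
  have wS := AS w wA.
  have xS : x \notin S.
    move: xS'; rewrite !inE negb_or => /andP[xu]; rewrite negb_and negbK.
    case/orP=> // /orP[]/eqP xE; move: wx; rewrite xE adj_sym.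
      case/nbr=> wE; first by rewrite -wE wA in zA.
        by rewrite wE v'S in wS.
      by rewrite wE eqxx in wu.
    case/nbr'=> wE; first by rewrite -wE wA in zA'.
      by rewrite wE vS in wS.
    by rewrite wE eqxx in wu.
  move: wA; rewrite !inE => /connect_trans; apply; apply: connect1; exact/and3P.
right=> x xT.
have : [|| x == v, x == v' | x == u].
  have /vertsP[f] := xT; rewrite TE !inE => /orP[/orP[]|] /eqP ->; rewrite ?gE ?aE ?bE !inE;
  by case/orP=> ->; rewrite ?orbT.
case/or3P=> /eqP xE; first by exists e; rewrite xE.
  by exists e'; rewrite xE.
rewrite {x}xE in xT *.
(* Some edge at [u] lies outside [T], since otherwise [v] and [v'] would separate [u] from [z]. *)
have [/existsP[f /andP[fT uf]]|none1] := boolP [exists f, (f \notin T) && (u \in ends f)].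
  exists f; split=> //; apply/subsetP => h; rewrite inE => uh; rewrite !inE orbC.
  have [//|hT /=] := boolP (h \in T); apply: contraNT none => hf.
  by apply/existsP; exists h; apply/existsP; exists f; rewrite hf hT fT uh uf.
exfalso; have V2 : #|[set v; v']| < 3 by rewrite cards2; case: (_ != _).
have uV : u \notin [set v; v'] by rewrite !inE negb_or eq_sym vu eq_sym v'u.
have zV : z \notin [set v; v'].
  by rewrite !inE negb_or zv' eq_sym (ends_neq G_simple zE).
have /connectP[[|w p] /=] := k_connected_off G_3conn V2 uV zV.
  by move=> _ zE1; rewrite zE1 eqxx in zu.
case/andP=> /and3P[_ wV /adjP[h _ hE]] _ _; have uw := ends_neq G_simple hE.
have : h \in T.
  apply: contraNT none1 => hT; apply/existsP; exists h; rewrite hT hE !inE eqxx //.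
rewrite TE !inE => /orP[/orP[]|] /eqP hh.
- have : u \in ends g by rewrite -hh hE !inE eqxx.
  by rewrite gE (negbTE uV).
- have : w \in ends a by rewrite -hh hE !inE eqxx orbT.
  by rewrite aE => /set2P[] wE; move: wV uw; rewrite wE !inE ?eqxx.
- have : w \in ends b by rewrite -hh hE !inE eqxx orbT.
  by rewrite bE => /set2P[] wE; move: wV uw; rewrite wE !inE ?eqxx ?orbT.
Qed.
End Corner.


(** * Forests *)

Section Forests.
Variable G : mgraph.
Hypothesis G_simple : simple G.
Implicit Types (A C D O T X : {set edge G}) (W : {set vert G}) (FF : {set {set edge G}}) (e : edge G) (v : vert G).

Lemma forestP D :
  reflect (forall C, C \subset D -> ~ circuit C) (forest D).
Proof.
apply: (iffP forallP) => h C; first by move=> CD; apply/negP; apply: implyP (h C) CD.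
by apply/implyP => /h/negP.
Qed.

Lemma forest_sub D D' : D' \subset D -> forest D -> forest D'.
Proof. by move=> DD /forestP h; apply/forestP => C CD; apply/h/(subset_trans CD). Qed.

Lemma circuit_gt2 C : circuit C -> 2 < #|C|.
Proof.
move=> Cc; have /set0Pn[e eC] := circuit_neq0 Cc.
have /card_gt0P[v ve] : 0 < #|ends e| by case/andP: (card_ends e).
have [w wv E] := other_end G_simple ve.
have [e1 [e1C e1e ve1]] := circuit_other G_simple Cc eC ve.
have we : w \in ends e by rewrite E !inE eqxx orbT.
have [e2 [e2C e2e we2]] := circuit_other G_simple Cc eC we.
have e12 : e1 != e2.
  apply: contraNneq e1e => e12; rewrite -e12 in we2.
  by apply/eqP/(ends_inj G_simple); rewrite E; apply: ends_set2; rewrite // eq_sym.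
have <- : #|[set e; e1; e2]| = 3 by rewrite cards3 //= !inE negb_or !(eq_sym e) e1e e2e e12.
by apply/subset_leq_card; rewrite !subUset !sub1set eC e1C e2C.
Qed.

Lemma forest_le2 D : #|D| <= 2 -> forest D.
Proof.
move=> D2; apply/forestP => C CD /circuit_gt2; apply/negP; rewrite -leqNgt.
exact: leq_trans (subset_leq_card CD) D2.
Qed.

(** Each edge of [O] is pendant in the union, so no circuit can pass through it. *)
Lemma forest_leafU A O : forest A ->
    (forall e, e \in O -> exists2 v, v \in ends e & inc (A :|: O) v \subset [set e]) ->
  forest (A :|: O).
Proof.
move=> /forestP Af leaf; apply/forestP => C CAO Cc.
have [CA|] := boolP (C \subset A); first exact: Af CA Cc.
case/subsetPn=> e eC eA; have eO : e \in O by have := subsetP CAO e eC; rewrite inE (negbTE eA).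
have [v ve sub] := leaf e eO; have [e' [e'C e'e ve']] := circuit_other G_simple Cc eC ve.
have : e' \in [set e] by apply: (subsetP sub); rewrite in_inc ve' (subsetP CAO).
by rewrite inE (negbTE e'e).
Qed.

Lemma incidence_sum D W :
  \sum_(v in W) #|inc D v| = \sum_(e in D) #|ends e :&: W|.
Proof.
under eq_bigr => v _ do rewrite -sum1_card.
rewrite (exchange_big_dep (fun e => e \in D)) /=; last first.
  by move=> v e _; rewrite in_inc => /andP[].
apply: eq_bigr => e eD; rewrite sum1_card.
by apply: eq_card => v; rewrite unfold_in /= in_inc eD andbT in_setI andbC.
Qed.

Lemma handshake D W : verts D \subset W -> \sum_(v in W) #|inc D v| = #|D| * 2.
Proof.
move=> DW; rewrite incidence_sum -sum_nat_const; apply: eq_bigr => e eD.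
have /setIidPl -> : ends e \subset W by apply: subset_trans DW; apply: bigcup_sup.
by case: G_simple.
Qed.

(** A local substitute for circuits: it allows isolated vertices and says nothing about
    connectedness, and its minimal nonempty instances are circuits. *)
Definition leafless D := [forall v, #|inc D v| != 1].

(** By induction, an edge is deleted together with an end of degree 1; the other end keeps [W]
    nonempty. *)
Lemma leafless_free_bound D W :
    (forall D', D' \subset D -> leafless D' -> D' = set0) ->
  verts D \subset W -> 0 < #|W| -> #|D| < #|W|.
Proof.
move: {2}#|D| (leqnn #|D|) => n; elim: n D W => [|n IHn] D W.
  by rewrite leqn0 => /eqP ->.
move=> Dn Dfree DW W0; have [->|D0] := eqVneq D set0; first by rewrite cards0.
have /forallPn[v /negPn/cards1P[e De]] : ~~ leafless D.
  by apply: contraNN D0 => /Dfree ->.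
have /andP[ve eD] : (v \in ends e) && (e \in D) by rewrite -in_inc De inE.
have [w wv E] := other_end G_simple ve.
have vW : v \in W by apply: (subsetP DW); apply/vertsP; exists e.
have wW : w \in W.
  by apply: (subsetP DW); apply/vertsP; exists e; rewrite // E !inE eqxx orbT.
rewrite (cardsD1 e) eD (cardsD1 v W) vW ltn_add2l; apply: IHn.
- by move: Dn; rewrite (cardsD1 e D) eD ltnS.
- by move=> D' D'D; apply: Dfree; apply: subset_trans D'D (subsetDl _ _).
- apply/subsetP => x /vertsP[f]; rewrite !inE => /andP[fe fD] xf.
  rewrite (subsetP DW) ?andbT; last by apply/vertsP; exists f.
  apply: contraNneq fe => xv; rewrite -in_set1 -De in_inc fD andbT -xv //.
- by apply/card_gt0P; exists w; rewrite !inE wv.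
Qed.

(* Removing one edge leaves no leafless subset, so [D] has at most as many edges
   as vertices; by the handshake lemma all degrees are 2. *)
Lemma min_leafless_circuit D : D != set0 -> leafless D ->
    (forall D', D' \subset D -> leafless D' -> D' != set0 -> D' = D) ->
  circuit D.
Proof.
move=> D0 Dl Dmin; set V := verts D.
have [e eD] := set0Pn _ D0.
have /card_gt0P[v ve] : 0 < #|ends e| by case/andP: (card_ends e).
have VV : verts (D :\ e) \subset V.
  by apply/subsetP => x /vertsP[f /setD1P[_ fD] xf]; apply/vertsP; exists f.
have V0 : 0 < #|V| by apply/card_gt0P; exists v; apply/vertsP; exists e.
have DV : #|D| <= #|V|.
  rewrite (cardsD1 e) eD; apply: leafless_free_bound VV V0 => D' D'D D'l.
  apply/eqP; apply: contraTT (eD) => /(Dmin D' _ D'l) <-.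
    by apply/negP => /(subsetP D'D); rewrite !inE eqxx.
  exact: subset_trans D'D (subsetDl _ _).
have deg2 u : u \in V -> 2 <= #|inc D u|.
  case/vertsP=> f fD uf; have := forallP Dl u; have : 0 < #|inc D u|.
    by apply/card_gt0P; exists f; rewrite in_inc uf.
  by case: #|_| => [|[]].
have degE u : u \in V -> #|inc D u| = 2.
  have /= [le_sum eq_sum] := leqif_sum (fun u (uV : u \in V) => leqif_eq (deg2 u uV)).
  have : \sum_(u in V) #|inc D u| <= \sum_(u in V) 2.
    by rewrite handshake // sum_nat_const leq_mul2r DV.
  move=> le; move: eq_sum; rewrite eqn_leq le_sum le => /esym/forall_inP h uV.
  by apply/esym/eqP/h.
apply/and3P; split=> //; last first.
  by apply/forallP => u; rewrite edge_induced_deg // degE // (valP u).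
apply/forallP => x; apply/forallP => y.
(* Connectedness follows from minimality: the part of [D] reachable from [x] is nonempty and
   leafless, hence all of [D]. *)
pose D' := [set f in D | [exists a in ends f, connect (adj D) (val x) a]].
have memD' f a : a \in ends f -> (f \in D') = (f \in D) && connect (adj D) (val x) a.
  move=> af; rewrite inE; case fD: (f \in D) => //=.
  apply/existsP/idP => [[b /andP[bf xb]]|xa]; last by exists a; rewrite af.
  have [<-//|ba] := eqVneq b a; apply: connect_trans xb (connect1 _).
  by apply/adjP; exists f => //; apply: ends_set2.
have DD' : D' = D.
  apply: Dmin; first by apply/subsetP => f; rewrite inE => /andP[].
    apply/forallP => u; have [xu|xu] := boolP (connect (adj D) (val x) u).
      have -> : inc D' u = inc D u; last exact: (forallP Dl u).
      apply/setP => f; rewrite !in_inc; case uf: (u \in ends f) => //=.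
      by rewrite (memD' f u uf) xu andbT.
    have -> : inc D' u = set0; last by rewrite cards0.
    apply/setP => f; rewrite in_inc in_set0; case uf: (u \in ends f) => //=.
    by rewrite (memD' f u uf) (negbTE xu) andbF.
  have /vertsP[f fD xf] := valP x; apply/set0Pn; exists f.
  by rewrite (memD' f (val x)) // fD connect0.
have xy : connect (adj D) (val x) (val y).
  have /vertsP[f fD yf] := valP y; move: (fD); rewrite -{1}DD' (memD' f (val y)) //.
  by case/andP.
have homo a b : adj D a b ->
    connect (adj [set: edge (edge_induced D)]) (insubd x a) (insubd x b).
  move=> ab; apply: connect1; case/adjP: (ab) => f fD fE.
  by rewrite adj_subgraph !insubdK //; apply/bigcupP; exists f; rewrite // fE !inE eqxx ?orbT.
by have := connect_homo homo xy; rewrite !valKd.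
Qed.

(** A nonempty leafless subset of [D] would contain a minimal one, which is a circuit. *)
Lemma forest_bound D W :
  forest D -> verts D \subset W -> 0 < #|W| -> #|D| < #|W|.
Proof.
move=> /forestP Df; apply: leafless_free_bound => D1 D1D D1l.
apply/eqP/negPn/negP => D10.
pose P D' := (D' != set0) && leafless D'.
have [D2 /minsetP[/andP[D20 D2l] D2min] D21] : {D2 | minset P D2 & D2 \subset D1}.
  by apply: minset_exists; rewrite /P D10.
apply: (Df D2); first exact: subset_trans D21 D1D.
by apply: min_leafless_circuit => // D3 D32 D3l D30; apply: D2min; rewrite // /P D30.
Qed.

Lemma rank_forest X : exists2 R, forest R /\ R \subset X & #|R| = rank X.
Proof.
have [R0 R0P _] : {R0 : {set edge G} |
    maxset (fun D : {set edge G} => (D \subset X) && forest D) R0 & set0 \subset R0}.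
  by apply: maxset_exists; rewrite sub0set forest_le2 ?cards0.
have [|R RP RE] := @eq_bigmax_cond _ (spanning_forest X) (fun F : {set edge G} => #|F|).
  by apply/card_gt0P; exists R0.
by exists R; [by case/maxsetP: RP => /andP[] | exact: esym RE].
Qed.

(** Each circuit in the cover lies in a single member, so acyclicity can be tested member by
    member. *)
Lemma forest_free FF D : free_family FF -> D \subset cover FF ->
  (forall X, X \in FF -> forest (D :&: X)) -> forest D.
Proof.
move=> [_ free] DF DX; apply/forestP => C CD Cc.
have [X XF CX] := free C Cc (subset_trans CD DF).
by apply: (forestP _ (DX X XF) C) Cc; rewrite subsetI CD.
Qed.
End Forests.


(** * Inner fans *)

Lemma infix_nth3 (T : eqType) (x : T) s j : j.+2 < size s ->
  infix [:: nth x s j; nth x s j.+1; nth x s j.+2] s.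
Proof.
move=> js; apply/infixP; exists (take j s), (drop j.+3 s).
rewrite -{1}(cat_take_drop j s) (drop_nth x (n := j)); last by lia.
by rewrite (drop_nth x (n := j.+1)) ?(drop_nth x (n := j.+2)); first done; lia.
Qed.

Lemma infix_nth4 (T : eqType) (x : T) s j : j.+3 < size s ->
  infix [:: nth x s j; nth x s j.+1; nth x s j.+2; nth x s j.+3] s.
Proof.
move=> js; apply/infixP; exists (take j s), (drop j.+4 s).
rewrite -{1}(cat_take_drop j s) (drop_nth x (n := j)); last by lia.
rewrite (drop_nth x (n := j.+1)); last by lia.
by rewrite (drop_nth x (n := j.+2)) ?(drop_nth x (n := j.+3)); first done; lia.
Qed.

Lemma set3_rev (T : finType) (a b c : T) : [set a; b; c] = [set c; b; a].
Proof. by apply/setP => x; rewrite !inE orbC [X in _ || X]orbC orbA. Qed.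

Lemma set_seq3 (T : finType) (a b c : T) : [set:: [:: a; b; c]] = [set a; b; c].
Proof. by apply/setP => x; rewrite !inE orbA. Qed.

Section FanMembers.
Variable G : mgraph.
Hypothesis G_simple : simple G.
Implicit Types (A C D X T : {set edge G}) (e : edge G).

Lemma wye_edges_at X : wye X -> exists2 v, edges_at v = X & #|X| = 3.
Proof. by case=> _ [v]; rewrite deg_simple // => d3 ->; exists v. Qed.

Lemma wye_not_triangle X : wye X -> ~ triangle X.
Proof.
case/wye_edges_at=> v <- v3 [Xc _].
have /card_gt0P[e eX] : 0 < #|edges_at v| by rewrite v3.
have := circuit_deg (v := v) G_simple Xc; rewrite /inc setIid v3; move=> h.
suff /h : v \in verts (edges_at v) by [].
by apply/vertsP; exists e => //; move: eX; rewrite inE.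
Qed.

(** The wye consists of all edges at its centre [v], and two of them lie in the triangle, so [e] is
    the only edge leaving it at [v]. *)
Lemma wye_corner (e f g h : edge G) : uniq [:: e; f; g; h] ->
    wye [set e; f; g] -> triangle [set f; g; h] ->
  exists2 v, edges_at v = [set e; f; g] & corner [set f; g; h] v e.
Proof.
move=> /= /and3P[eN _ _] /wye_edges_at[v vE _] Tt; exists v => //.
have at_v k : k \in [set e; f; g] -> v \in ends k by rewrite -vE inE.
split=> //.
- by apply/vertsP; exists f; [rewrite !inE eqxx | apply: at_v; rewrite !inE eqxx orbT].
- by move: eN; rewrite !inE orbA.
- by apply: at_v; rewrite !inE eqxx.
- by rewrite vE; apply/subsetP => k; rewrite !inE -!orbA => /or3P[] ->; rewrite ?orbT.
Qed.

(** * Positions in a wye-to-wye ordering *)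

Section Ordering.
Variables (X : {set edge G}) (s : seq (edge G)) (x0 : edge G).
Hypothesis sP : wye_to_wye_ordering X s.

Let w j := [set nth x0 s j; nth x0 s j.+1; nth x0 s j.+2].

Lemma ordering_uniq : uniq s.
Proof. by case: sP => [[]]. Qed.

Lemma ordering_nth_eq i j : i < size s -> j < size s ->
  (nth x0 s i == nth x0 s j) = (i == j).
Proof. by move=> *; apply: nth_uniq ordering_uniq. Qed.

Lemma ordering_size_ge3 : 2 < size s.
Proof.
case: sP => _ /wye_edges_at[v _ c3] _; move: (cardsE (mem (take 3 s))); rewrite c3.
have := card_size (take 3 s); rewrite size_take => + e3; rewrite -e3.
by case: ifP => //; lia.
Qed.

(** The first triple is a wye, and the equivalence for four consecutive edges makes wyes and
    triangles alternate, because no wye is a triangle. Hence position [2i] holds [x_i] and position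
    [2i - 1] holds [y_i]. *)
Lemma ordering_alternates j : j.+2 < size s ->
  if odd j then triangle (w j) else wye (w j).
Proof.
case: sP => [[_ _ or3 iff4] w0 _]; elim: j => [|j IHj] js.
  move: w0 js; rewrite /w; case: s => [|a [|b [|c s']]] //=.
  by rewrite take0 set_seq3.
have [wt tw] := iff4 _ _ _ _ (infix_nth4 x0 js).
have := IHj (ltnW js); rewrite /=; case: (odd j) => /= wj; last exact: wt.
by case: (or3 _ _ _ (infix_nth3 x0 js)) => // /tw /wye_not_triangle.
Qed.

(** The last triple is a wye and begins at position [size s - 3], which must therefore be even. *)
Lemma ordering_odd : odd (size s).
Proof.
have s3 := ordering_size_ge3; case: sP => _ _ wend.
have /ordering_alternates : (size s - 3).+2 < size s by lia.
have -> : w (size s - 3) = [set:: drop (size s - 3) s].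
  have [k kN] : exists k, size s = k.+3 by exists (size s - 3); lia.
  have -> : size s - 3 = k by lia.
  rewrite /w -set_seq3 (drop_nth x0 (n := k)) 1?(drop_nth x0 (n := k.+1)); try lia.
  by rewrite (drop_nth x0 (n := k.+2)) ?drop_oversize //; lia.
case: ifP => o; first by move/wye_not_triangle: wend.
by move: o; rewrite oddB //= addbT => /negbFE.
Qed.

Lemma ordering_corner j : ~~ odd j -> j.+3 < size s ->
  exists2 v, edges_at v = w j & corner (w j.+1) v (nth x0 s j).
Proof.
move=> jo js; apply: wye_corner.
- by rewrite /= !inE !ordering_nth_eq; lia.
- by have := ordering_alternates (ltnW js); rewrite (negbTE jo).
- by have := ordering_alternates (j := j.+1) js; rewrite /= jo.
Qed.

(** The mirror image of [ordering_corner], with the ordering read backwards. *)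
Lemma ordering_corner_rev j : odd j -> j.+3 < size s ->
  exists2 v, edges_at v = w j.+1 & corner (w j) v (nth x0 s j.+3).
Proof.
move=> jo js; rewrite /w set3_rev [X in corner X]set3_rev; apply: wye_corner.
- by rewrite /= !inE !ordering_nth_eq; lia.
- by have := ordering_alternates (j := j.+1) js; rewrite /= jo /w set3_rev.
- by have := ordering_alternates (ltnW js); rewrite jo /w set3_rev.
Qed.

(** The positions are those of [y_1, x_1, ..., y_k]. Each further triangle shares an edge [y_i] with
    the earlier ones, so it adds at most one vertex. *)
Lemma ordering_verts k : 0 < k -> k.*2 < size s ->
  exists2 W : {set vert G}, #|W| <= k.+1 &
    forall j, 0 < j < k.*2 -> ends (nth x0 s j) \subset W.
Proof.
case: k => // k _; elim: k => [|k IHk] ks.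
  exists (ends (nth x0 s 1)); first by case/andP: (card_ends (nth x0 s 1)).
  by case=> [|[]].
have [|W Wk WP] := IHk; first by lia.
have /ordering_alternates : k.*2.+1.+2 < size s by lia.
rewrite /= odd_double /= => Tt; exists (W :|: verts (w k.*2.+1)).
  rewrite cardsU (card_triangle_verts G_simple Tt).
  have : #|ends (nth x0 s k.*2.+1)| <= #|W :&: verts (w k.*2.+1)|.
    apply/subset_leq_card; rewrite subsetI WP ?doubleS //=.
    by apply: bigcup_sup; rewrite !inE eqxx.
  by case: G_simple => -> _; lia.
move=> j jk; case: (ltnP j k.+1.*2) => jk'.
  by apply: subset_trans (WP j _) (subsetUl _ _); lia.
apply: subset_trans (subsetUr _ _); apply: bigcup_sup; rewrite !inE.
have /orP[] : (j == k.*2.+2) || (j == k.*2.+3) by lia.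
  by move=> /eqP ->; rewrite eqxx orbT.
by move=> /eqP ->; rewrite eqxx !orbT.
Qed.
End Ordering.

(** * The three kinds of inner fans *)

Section Inner.
Variable H : mgraph.
Hypotheses (H2 : forall h : edge H, #|ends h| = 2) (G_3conn : k_connected 3 G).

(* Inner fans with [n >= 3] are rich, by [A = {x_1, ..., x_(n-1)}]. *)
Definition rich_member X := has_minor H (contract X) /\ exists A,
  [/\ A \subset X, forest A, forall e, e \in A -> contractible H e,
      forall D, D \subset X -> forest D -> #|D| < #|A|.*2
    & forall e, e \in X -> exists C, [/\ circuit C, e \in C & C \subset X]].

(** These are the inner fans with [n = 2]; [e] and [e'] are the outer edges [x_0] and [x_2]. *)
Definition triangle_member T := has_minor H (contract T) /\
  exists v v' e e', [/\ corner T v e, corner T v' e', v != v' & e != e'].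

Lemma inner_fan_member X : inner_fan H X ->
  [\/ exists2 e, X = [set e] & contractible H e, triangle_member X | rich_member X].
Proof.
case=> Y [x0 [xn [t [_ sP XE X3 Xm]]]]; set s := x0 :: _ in sP.
have s_size : size s = (size t).+2 by rewrite /= size_rcons.
have s3 := ordering_size_ge3 sP; have so := ordering_odd x0 sP.
have nth_t j : j < size t -> nth x0 s j.+1 = nth x0 t j by move=> jt; rewrite /= nth_rcons jt.
have memX j : 0 < j -> j.+1 < size s -> nth x0 s j \in X.
  case: j => // j _; rewrite s_size !ltnS => jt; rewrite nth_t // XE inE; exact: mem_nth.
have memXP e : e \in X -> exists2 j, 0 < j < (size s).-1 & e = nth x0 s j.
  rewrite XE inE => /(nthP x0)[j jt <-]; exists j.+1; last by rewrite nth_t.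
  by rewrite s_size.
have nth_eq := ordering_nth_eq x0 sP.
have [n sn] : exists n, size s = n.*2.+1.
  by exists (size s)./2; rewrite -[LHS]odd_double_half so.
have [n1|[n2|n3]] : n = 1 \/ n = 2 \/ 2 < n by lia.
- constructor 1; rewrite sn n1 in s_size; case: t s_size XE {sP s sn nth_t memX memXP nth_eq s3 so} => [|y []] // _ XE.
  have XE' : X = [set y] by rewrite XE; apply/setP => e; rewrite !inE.
  by exists y => //; split; rewrite -XE'.
- constructor 2; split=> //.
  have [|v vE vc] := ordering_corner x0 sP (j := 0) isT; first by lia.
  have [|v' v'E vc'] := ordering_corner_rev x0 sP (j := 1) isT; first by lia.
  have XE' : X = [set nth x0 s 1; nth x0 s 2; nth x0 s 3].
    apply/setP => e; apply/idP/idP => [/memXP[j jn ->]|].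
      have : [|| j == 1, j == 2 | j == 3] by lia.
      by case/or3P=> /eqP ->; rewrite !inE eqxx ?orbT.
    by rewrite !inE -orbA => /or3P[] /eqP ->; apply: memX; lia.
  exists v, v', (nth x0 s 0), (nth x0 s 4); rewrite XE'; split=> //; last first.
    by rewrite nth_eq //; lia.
  apply: contraTneq (isT : true) => vv'.
  have : nth x0 s 0 \in edges_at v' by rewrite -vv' vE !inE eqxx.
  by rewrite v'E !inE !nth_eq //; lia.
constructor 3; split=> //.
pose f (i : 'I_n.-1) := nth x0 s i.+1.*2.
have f_lt (i : 'I_n.-1) : 0 < i.+1.*2 < n.*2 by have := ltn_ord i; lia.
have cardA : #|f @: setT| = n.-1.
  rewrite card_imset ?cardsT ?card_ord // => i j /eqP; rewrite nth_eq.
  - by move=> /eqP ij; apply: val_inj => /=; lia.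
  - by have := f_lt i; lia.
  - by have := f_lt j; lia.
have AX : f @: setT \subset X.
  by apply/subsetP => _ /imsetP[i _ ->]; apply: memX; have := f_lt i; lia.
exists (f @: setT); split=> //.
- apply/forestP => C CA Cc.
  have exC : exists i, (i.*2 < size s) && (nth x0 s i.*2 \in C).
    have /set0Pn[e eC] := circuit_neq0 Cc.
    have /imsetP[i _ eE] := subsetP CA e eC; exists i.+1.
    by rewrite -/(f i) -eE eC andbT; have := f_lt i; lia.
  have evenA j : j < size s -> nth x0 s j \in C -> 0 < j /\ ~~ odd j.
    move=> js /(subsetP CA)/imsetP[i _ /eqP]; have fi := f_lt i.
    by rewrite nth_eq => [/eqP -> | |]; [rewrite odd_double | | lia].
  (* Take the edge [x_i] of [C] with least index. At the centre of the wye formed by [x_(i-1)],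
     [y_i] and [x_i], a second edge of [C] would have a smaller index or be some [y_i]. *)
  case: (ex_minnP exC) => i /andP[iN iC] imin.
  have [i0 _] := evenA _ iN iC; case: i => // i in iN iC imin i0 *.
  have := @ordering_alternates _ _ x0 sP i.*2; rewrite -doubleS odd_double => /(_ iN).
  case/wye_edges_at => v vE _.
  have at_v k : k \in [set nth x0 s i.*2; nth x0 s i.*2.+1; nth x0 s i.*2.+2] -> v \in ends k.
    by rewrite -vE inE.
  have [|e [eC ei ve]] := circuit_other G_simple Cc iC (v := v).
    by apply: at_v; rewrite !inE eqxx !orbT.
  have : e \in edges_at v by rewrite inE.
  rewrite vE !inE -orbA => /or3P[]/eqP eE.
  + have /imin : (i.*2 < size s) && (nth x0 s i.*2 \in C) by rewrite -eE eC andbT; lia.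
    by rewrite ltnn.
  + by rewrite eE in eC; have [|_] := evenA _ _ eC; lia.
  + by rewrite eE eqxx in ei.
- move=> e eA; split; last by apply: contract_minor_mem Xm => //; apply: (subsetP AX).
  case/imsetP: eA => i _ ->; have := f_lt i; rewrite /f; move: (i : nat) => {}i ilt.
  (* Each edge but [x_(n-1)] leaves a triangle that follows it in the ordering. The edge [x_(n-1)]
     leaves the triangle of [y_(n-2)], [x_(n-2)] and [y_(n-1)], which exists because [n >= 3]. *)
  have [in3|in3] := ltnP i.+2 n.
    have [| |v _ c] := ordering_corner x0 sP (j := i.+1.*2); first by rewrite odd_double.
      by lia.
    exact: corner_3connected c.
  have [| |v _ c] := ordering_corner_rev x0 sP (j := i.*2.-1); [lia|lia|].
  by have -> : i.+1.*2 = i.*2.-1.+3; [lia | apply: corner_3connected c].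
(* The inner fan has at most [n + 1] vertices, so a forest in it has at most [n < 2 (n - 1)]
   edges. *)
- move=> D DX Df; rewrite cardA.
  have [| |W Wn WP] := ordering_verts x0 sP (k := n); [lia|lia|].
  have DW : verts D \subset W.
    apply/subsetP => x /vertsP[e /(subsetP DX)/memXP[j jn ->]]; apply/subsetP/WP; lia.
  have [->|/set0Pn[e eD]] := eqVneq D set0; first by rewrite cards0; lia.
  have W0 : 0 < #|W|.
    have /card_gt0P[x xe] : 0 < #|ends e| by case/andP: (card_ends e).
    by apply/card_gt0P; exists x; apply: (subsetP DW); apply/vertsP; exists e.
  by have := forest_bound G_simple Df DW W0; lia.
move=> e /memXP[j jn ->].
have tri k : odd k -> k.+3 < size s -> circuit [set nth x0 s k; nth x0 s k.+1; nth x0 s k.+2] /\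
    [set nth x0 s k; nth x0 s k.+1; nth x0 s k.+2] \subset X.
  move=> ko ks; have := ordering_alternates x0 sP (ltnW ks); rewrite ko => -[Tc _]; split=> //.
  by rewrite !subUset !sub1set !memX //; lia.
have [jo|je] := boolP (odd j); last first.
  have [| |Tc TX] := tri j.-1; [lia|lia|].
  exists [set nth x0 s j.-1; nth x0 s j.-1.+1; nth x0 s j.-1.+2]; split=> //.
  by rewrite prednK ?inE ?eqxx ?orbT; lia.
have [js|js] := ltnP j.+3 (size s).
  have [Tc TX] := tri j jo js; eexists; split; [exact: Tc | | exact: TX].
  by rewrite !inE eqxx.
have [| |Tc TX] := tri (j - 2); [lia|lia|].
exists [set nth x0 s (j - 2); nth x0 s (j - 2).+1; nth x0 s (j - 2).+2]; split=> //.
by rewrite (_ : (j - 2).+2 = j) ?inE ?eqxx ?orbT; lia.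
Qed.
End Inner.
End FanMembers.


(** * Free fan families *)

Lemma card_trivIset_cover (T : finType) (P : {set {set T}}) (D : {set T}) :
  trivIset P -> D \subset cover P -> #|D| = \sum_(X in P) #|D :&: X|.
Proof.
move=> tiP DP; have -> : #|D| = \sum_(x in cover P) (x \in D).
  rewrite -sum1_card [RHS]big_mkcond [LHS]big_mkcond; apply: eq_bigr => x _.
  by case: (boolP (x \in D)) => [/(subsetP DP) -> | _] //; case: ifP.
rewrite big_trivIset //; apply: eq_bigr => X _.
rewrite -sum1_card [RHS]big_mkcond [LHS]big_mkcond; apply: eq_bigr => x _.
by rewrite in_setI andbC; case: (x \in X) => //=; case: (x \in D).
Qed.

Lemma trivIset_eq (T : finType) (P : {set {set T}}) X Y (x : T) :
  trivIset P -> X \in P -> Y \in P -> x \in X -> x \in Y -> X = Y.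
Proof.
move=> /trivIsetP tiP XP YP xX xY; apply/eqP; apply: contraTT (xX) => XY.
by rewrite (disjointFl (tiP _ _ XP YP XY)).
Qed.

Section Families.
Variables (G H : mgraph) (FF : {set {set edge G}}).
Hypotheses (G_simple : simple G) (G_3conn : k_connected 3 G).
Hypotheses (H2 : forall h : edge H, #|ends h| = 2).
Hypotheses (FF_fan : fan_family H FF) (FF_free : free_family FF).
Implicit Types (A C D O T X : {set edge G}) (e f : edge G) (v u : vert G).

Let tiFF : trivIset FF := proj1 FF_fan.

Definition cornerb T v e :=
  [&& circuit T, #|T| == 3, v \in verts T, e \notin T, v \in ends e
    & edges_at v \subset e |: T].

Lemma cornerbP T v e : reflect (corner T v e) (cornerb T v e).
Proof.
apply: (iffP and5P) => [[Tc /eqP T3 vT eT /andP[ve sub]]|[[Tc T3] vT eT ve sub]].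
  by split.
by split=> //; [apply/eqP | rewrite ve].
Qed.

Definition cubic_triangle T :=
  [&& circuit T, #|T| == 3 & [forall u in verts T, exists f, cornerb T u f]].

Lemma cubic_triangleP T : reflect
  (triangle T /\ forall u, u \in verts T -> exists f, corner T u f) (cubic_triangle T).
Proof.
apply: (iffP and3P) => [[Tc /eqP T3 /forall_inP h]|[[Tc T3] h]]; split=> //.
- by move=> u /h/existsP[f /cornerbP]; exists f.
- exact/eqP.
- by apply/forall_inP => u /h[f c]; apply/existsP; exists f; apply/cornerbP.
Qed.

Lemma corner_contractible T v e :
  corner T v e -> has_minor H (contract T) -> contractible H e.
Proof. by move=> c m; split; [exact: corner_3connected c | exact: corner_minor c m]. Qed.

(** A circuit through [e] uses a second edge at [v], which lies in [T]; as members are disjoint, [X]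
    would be [T], which misses [e]. *)
Lemma corner_notin_circuit T v e X C : T \in FF -> X \in FF ->
  corner T v e -> circuit C -> C \subset X -> e \notin C.
Proof.
move=> TF XF c Cc CX; apply/negP => eC; have [_ _ eT ve sub] := c.
have [e' [e'C e'e ve']] := circuit_other G_simple Cc eC ve.
have : e' \in e |: T by apply: (subsetP sub); rewrite inE.
rewrite !inE (negbTE e'e) /= => e'T.
have TX := trivIset_eq tiFF TF XF e'T (subsetP CX _ e'C).
by rewrite TX (subsetP CX) in eT.
Qed.

Definition good X A := [/\ A \subset X, forest A,
  forall e, e \in A -> contractible H e
  & forall D, D \subset X -> forest D -> #|D| <= #|A|.*2].

(** [good] bounds the rank of [X] by twice the size of [A]. Strictness in one member pays for the
    [+ 1] under the ceiling. *)
Definition better X A :=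
  [forall (D : {set edge G} | (D \subset X) && forest D), #|D| < #|A|.*2].

Lemma betterP X A :
  reflect (forall D, D \subset X -> forest D -> #|D| < #|A|.*2) (better X A).
Proof.
apply: (iffP forall_inP) => h D; first by move=> DX Df; apply: h; rewrite DX.
by case/andP; apply: h.
Qed.

Lemma triangle_forest_le2 T D : triangle T -> D \subset T -> forest D -> #|D| <= 2.
Proof.
case=> Tc T3 DT Df; have := subset_leq_card DT; rewrite T3 leq_eqVlt ltnS => /orP[/eqP D3|//].
have DE : D = T by apply/eqP; rewrite eqEcard DT T3 D3.
by case: (forestP _ Df T) => //; rewrite DE.
Qed.

Lemma set1_not_circuit e : ~~ circuit [set e].
Proof. by apply/negP => /(circuit_gt2 G_simple); rewrite cards1. Qed.

(** Together with [corner_notin_circuit], this shows that a member containing an edge that leaves a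
    triangle of the family is a singleton. *)
Lemma member_circuits X : X \in FF ->
  (exists e, X = [set e]) \/
  forall e, e \in X -> exists C, [/\ circuit C, e \in C & C \subset X].
Proof.
case: FF_fan => _ /[apply] -[/(inner_fan_member G_simple H2 G_3conn)|[e -> _]]; last first.
  by left; exists e.
case=> [[e -> _]|[_ [v [_ [_ [_ [[[Xc _] _ _ _ _] _ _ _]]]]]]|[_ [A [_ _ _ _ h]]]].
- by left; exists e.
- by right=> e eX; exists X.
- by right.
Qed.

(** A triangle with three cubic vertices is left to the global count. Any other triangle has a
    contractible edge by [triangle_corners], and one edge is half of its rank 2. *)
Lemma member_choice X : X \in FF ->
  if cubic_triangle X then has_minor H (contract X)
  else exists A, good X A /\ (better X A \/ triangle_member H X).
Proof.
move=> XF.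
have single e : contractible H e -> if cubic_triangle [set e] then has_minor H (contract [set e])
  else exists A, good [set e] A /\ (better [set e] A \/ triangle_member H [set e]).
  move=> ec; case: ifP => [/cubic_triangleP[[]]|_]; first by rewrite (negbTE (set1_not_circuit e)).
  have le1 D : D \subset [set e] -> #|D| <= 1 by move/subset_leq_card; rewrite cards1.
  exists [set e]; split; last by left; apply/betterP => D /le1 D1 _; rewrite cards1; lia.
  split=> //; first by apply: forest_le2; rewrite // cards1.
    by move=> e' /set1P ->.
  by move=> D /le1 D1 _; rewrite cards1; lia.
case: FF_fan => _ /(_ X XF) [/(inner_fan_member G_simple H2 G_3conn)|[e -> /single]] //.
case=> [[e -> /single]|[Xm [v [v' [e [e' [c c' vv' ee']]]]]]|[Xm [A [AX Af Ac Ab _]]]] //.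
  have Xt : triangle X by case: c.
  case: (triangle_corners G_simple G_3conn c c' vv') => [[g gX g3]|corners]; last first.
    by case: ifP => // /cubic_triangleP[].
  case: ifP => // _; exists [set g]; split.
    split; rewrite ?sub1set //; first by apply: forest_le2; rewrite // cards1.
      by move=> _ /set1P ->; split; last by apply: contract_minor_mem Xm.
    by move=> D DX Df; rewrite cards1; exact: triangle_forest_le2 Xt DX Df.
  by right; split=> //; exists v, v', e, e'.
case: ifP => // _; exists A; split; last by left; apply/betterP.
by split=> // D DX Df; apply/ltnW/Ab.
Qed.

(** The selected edges form a forest because the family is free. At its corner [v], an edge of [O]
    meets only edges of a triangle [T] that contributes nothing to the selection, so it is pendant
    there. *)
Lemma assemble (P : {set {set edge G}}) (sel : {set edge G} -> {set edge G}) O r :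
    P \subset FF ->
    (forall X, X \in P -> good X (sel X)) ->
    (forall X, X \in P -> [disjoint O & X]) ->
    (forall e, e \in O -> contractible H e) ->
    (forall e, e \in O -> exists T v, [/\ T \in FF, T \notin P, [disjoint O & T] & corner T v e]) ->
    r < #|O|.*2 + \sum_(X in P) #|sel X|.*2 ->
  exists F : {set edge G}, [/\ forest F, #|F| = uphalf r.+1
    & forall e, e \in F -> contractible H e].
Proof.
move=> PF selP OP Oc Ocorner rO.
pose A := \bigcup_(X in P) sel X.
have AP e : e \in A -> exists X, [/\ X \in P, X \in FF, e \in sel X & e \in X].
  case/bigcupP=> X XP eX; exists X; split=> //; first exact: subsetP PF X XP.
  by case: (selP X XP) => /subsetP/(_ e eX).
have AF : A \subset cover FF.
  by apply/subsetP => e /AP[X [_ XF _ eX]]; apply/bigcupP; exists X.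
have Af : forest A.
  apply: (forest_free FF_free AF) => X XF; have [XP|XP] := boolP (X \in P).
    have [_ sf _ _] := selP X XP; apply: forest_sub sf; apply/subsetP => e.
    by case/setIP=> /AP[Y [YP YF eY eY']] eX; rewrite (trivIset_eq tiFF XF YF eX eY').
  apply: (forest_sub (D := set0)); last by apply: forest_le2; rewrite // cards0.
  apply/subsetP => e /setIP[/AP[Y [YP YF _ eY]] eX].
  by rewrite (trivIset_eq tiFF XF YF eX eY) YP in XP.
have AOf : forest (A :|: O).
  apply: (forest_leafU G_simple Af) => e eO; have [T [v [TF TP OT c]]] := Ocorner e eO.
  have [_ _ eT ve sub] := c; exists v => //; apply/subsetP => f; rewrite in_inc => /andP[vf fAO].
  have : f \in e |: T by apply: (subsetP sub); rewrite inE.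
  rewrite !inE => /orP[// | fT]; move: fAO; rewrite inE => /orP[/AP[X [XP XF _ fX]]|fO].
    by rewrite (trivIset_eq tiFF TF XF fT fX) XP in TP.
  by rewrite (disjointFr OT fO) in fT.
have OA : #|A :|: O| = #|A| + #|O|.
  rewrite cardsU (_ : A :&: O = set0) ?cards0 ?subn0 //.
  apply/setP => e; rewrite in_set0; apply/negP => /setIP[/AP[X [XP _ _ eX]] eO].
  by rewrite (disjointFr (OP X XP) eO) in eX.
have cardA : \sum_(X in P) #|sel X|.*2 <= #|A|.*2.
  rewrite (card_trivIset_cover tiFF AF) -muln2 big_distrl /= [leqRHS](big_setID P) /=.
  rewrite (setIidPr PF); apply: leq_trans (leq_addr _ _); apply: leq_sum => X XP.
  rewrite muln2 leq_double; apply: subset_leq_card; rewrite subsetI.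
  by have [-> _ _ _] := selP X XP; rewrite bigcup_sup.
(* [uphalf r.+1 <= m] amounts to [r < 2m]. *)
have big : uphalf r.+1 <= #|A :|: O| by rewrite OA; lia.
have [F FAO Fcard] : exists2 F : {set edge G}, F \subset A :|: O & #|F| = uphalf r.+1.
  exists [set:: take (uphalf r.+1) (enum (A :|: O))].
    by apply/subsetP => e; rewrite inE => /mem_take; rewrite mem_enum.
  rewrite cardsE (card_uniqP _) ?take_uniq ?enum_uniq // size_takel //.
  by rewrite -cardE.
exists F; split=> //; first exact: forest_sub FAO AOf.
move=> e /(subsetP FAO); rewrite inE => /orP[/AP[X [XP _ eX _]]|]; last exact: Oc.
by have [_ _ h _] := selP X XP; apply: h.
Qed.

Theorem rank_contractible_forest : 0 < rank (cover FF) ->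
  exists F : {set edge G}, [/\ forest F, #|F| = uphalf (rank (cover FF)).+1
    & forall e, e \in F -> contractible H e].
Proof.
have [R [Rf RF] <-] := rank_forest G_simple (cover FF).
rewrite (card_trivIset_cover tiFF RF); set r := \sum_(X in FF) _ => r0.
have [sel selP] : exists sel : {set edge G} -> {set edge G}, forall X, X \in FF ->
    ~~ cubic_triangle X -> good X (sel X) /\ (better X (sel X) \/ triangle_member H X).
  apply: (fin_all_exists (P := fun X A => X \in FF -> ~~ cubic_triangle X ->
    good X A /\ (better X A \/ triangle_member H X))) => X; have [XF|XF] := boolP (X \in FF); last by exists set0.
  by have := member_choice XF; case: ifP => [_ _|_ [A AP]]; [exists set0 | exists A].
have Rsel X : X \in FF -> ~~ cubic_triangle X -> #|R :&: X| <= #|sel X|.*2.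
  move=> XF Xb; have [[_ _ _ +] _] := selP X XF Xb; apply; first exact: subsetIr.
  exact: forest_sub (subsetIl _ _) Rf.
pose B := [set X in FF | cubic_triangle X].
pose O := [set f | [exists X in B, exists v, cornerb X v f]].
have BP X : X \in B -> X \in FF /\ triangle X by rewrite inE => /andP[-> /cubic_triangleP[]].
have Bm X : X \in B -> has_minor H (contract X).
  by rewrite inE => /andP[XF Xc]; have := member_choice XF; rewrite Xc.
have OP f : f \in O -> exists X v, X \in B /\ corner X v f.
  by rewrite inE => /exists_inP[X XB /existsP[v /cornerbP c]]; exists X, v.
have Ocircuit f X C : f \in O -> X \in FF -> circuit C -> C \subset X -> f \notin C.
  by case/OP=> T [v [/BP[TF _] c]] XF; apply: corner_notin_circuit c.
have OB X : X \in B -> [disjoint O & X].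
  case/BP=> XF [Xc _]; rewrite disjoint_subset; apply/subsetP => f fO.
  by rewrite inE; apply: Ocircuit XF Xc _.
have Oc f : f \in O -> contractible H f.
  by case/OP=> X [v [XB c]]; apply: corner_contractible c (Bm X XB).
(* A member outside [B] that meets [O] will turn out to be a singleton; its edge is already in [O],
   so it makes no selection of its own. *)
pose P := [set X in FF | (X \notin B) && [disjoint O & X]].
have PF : P \subset FF by apply/subsetP => X; rewrite inE => /andP[].
have PB X : X \in P -> X \in FF /\ ~~ cubic_triangle X.
  by rewrite !inE => /and3P[XF + _]; rewrite XF.
have [B0 | B0] := posnP #|B|.
  have B00 : B = set0 by apply/eqP; rewrite -cards_eq0 B0.
  have nb X : X \in FF -> ~~ cubic_triangle X.
    by move=> XF; apply/negP => Xb; have := in_set0 X; rewrite -B00 inE XF Xb.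
  (* One member with a strict bound makes the whole sum strict, and no extra edges are needed. *)
  have [/exists_inP[T TF /betterP Tbetter]|worse] := boolP [exists X in FF, better X (sel X)].
    apply: (@assemble FF sel set0) => //.
    - by move=> X XF; case: (selP X XF (nb X XF)).
    - by move=> X _; rewrite -setI_eq0 set0I.
    - by move=> e; rewrite inE.
    - by move=> e; rewrite inE.
    rewrite cards0 add0n /r !(big_setD1 T TF) /= -addSn; apply: leq_add.
      by apply: Tbetter (subsetIr _ _) _; apply: forest_sub (subsetIl _ _) Rf.
    by apply: leq_sum => X /setD1P[_ XF]; apply: Rsel (nb X XF).
  have tri X : X \in FF -> triangle_member H X.
    move=> XF; case: (selP X XF (nb X XF)) => _ [Xb|//].
    by case/negP: worse; apply/exists_inP; exists X.
  have [T TF] : exists T, T \in FF.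
    by apply/set0Pn; apply: contraTneq r0 => F0; rewrite /r F0 big_set0.
  have [Tm [v [v' [e [e' [c c' vv' ee']]]]]] := tri T TF.
  have [[Tt vT eT ve sub] [_ v'T e'T ve' sub']] := (c, c').
  have e'v : e' \notin edges_at v.
    by apply/negP => /(subsetP sub); rewrite !inE eq_sym (negbTE ee') (negbTE e'T).
  have OX X : X \in FF -> [disjoint [set e; e'] & X].
    move=> XF; rewrite disjoint_subset; apply/subsetP => f fO; rewrite inE.
    have [v0 c0] : exists v0, corner T v0 f by case/set2P: fO => ->; [exists v | exists v'].
    have [_ [_ [_ [_ [_ [[[Xc _] _ _ _ _] _ _ _]]]]]] := tri X XF.
    exact: corner_notin_circuit TF XF c0 Xc _.
  have Tc : triangle T by case: c.
  apply: (@assemble (FF :\ T) sel [set e; e']).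
  - exact: subD1set.
  - by move=> X /setD1P[_ XF]; case: (selP X XF (nb X XF)).
  - by move=> X /setD1P[_ XF]; apply: OX.
  - by move=> f /set2P[] ->; [apply: corner_contractible c Tm | apply: corner_contractible c' Tm].
  - by move=> f /set2P[] ->; exists T; [exists v | exists v']; rewrite !inE eqxx; split=> //; apply: OX.
  (* [T] contributes at most 2 to the rank, whereas its two outer edges count 4. *)
  rewrite cards2 ee' /r (big_setD1 T TF) /= -addSn; apply: leq_add.
    apply: (@leq_ltn_trans 2) => //; apply: triangle_forest_le2 (subsetIr _ _) _ => //.
    exact: forest_sub (subsetIl _ _) Rf.
  by apply: leq_sum => X /setD1P[_ XF]; apply: Rsel (nb X XF).
have [k kP] : exists k : {set edge G} -> {set edge G}, forall X,
    X \in B -> k X \subset X /\ #|k X| = 2.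
  apply: (fin_all_exists (P := fun (X K : {set edge G}) => X \in B -> K \subset X /\ #|K| = 2)) => X.
  have [/BP[_ [Xc X3]]|XB] := boolP (X \in B); last by exists set0.
  have /set0Pn[e eX] := circuit_neq0 Xc; exists (X :\ e) => _; split; first exact: subD1set.
  by apply/eqP; have := cardsD1 e X; rewrite X3 eX; case: #|_| => [|[|[]]].
pose W := \bigcup_(X in B) verts X.
pose O2 := [set f in O | ends f \subset W].
pose E1 := [set f in O | [set f] \in FF].
pose E12 := [set f in E1 | ends f \subset W].
pose K := \bigcup_(X in B) k X.
have KP f : f \in K -> exists2 X, X \in B & f \in X.
  by case/bigcupP=> X XB fk; exists X => //; have [/subsetP/(_ f fk)] := kP X XB.
have KF : K \subset cover FF.
  by apply/subsetP => f /KP[X /BP[XF _] fX]; apply/bigcupP; exists X.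
have E1X f X : f \in E1 -> X \in FF -> f \in X -> X = [set f].
  by rewrite inE => /andP[_ fF] XF fX; apply: trivIset_eq tiFF XF fF fX (set11 f).
have E1B f X : f \in E1 -> X \in B -> f \notin X.
  move=> fE /BP[XF [_ X3]]; apply: contra_eqN X3 => fX.
  by rewrite (E1X f X fE XF fX) cards1.
have E12E f : f \in E12 -> f \in E1 by rewrite inE => /andP[].
(* By freeness each member is checked separately: it contributes two edges of a triangle, or at most
   one edge. *)
have Df : forest (E12 :|: K).
  apply: (forest_free FF_free).
    rewrite subUset KF andbT; apply/subsetP => f; rewrite !inE => /andP[/andP[_ fF] _].
    by apply/bigcupP; exists [set f]; rewrite ?set11.
  move=> X XF; have [XB|XB] := boolP (X \in B).
    apply: (forest_sub (D := k X)); last by apply: forest_le2; rewrite // (proj2 (kP X XB)).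
    apply/subsetP => f /setIP[/setUP[/E12E fE|/bigcupP[Y YB fY]] fX].
      by rewrite (negbTE (E1B f X fE XB)) in fX.
    have [/subsetP/(_ f fY) fY' _] := kP Y YB; have [YF _] := BP Y YB.
    by rewrite (trivIset_eq tiFF XF YF fX fY').
  apply: (forest_le2 G_simple); have [->|/set0Pn[f /setIP[fD fX]]] := eqVneq ((E12 :|: K) :&: X) set0.
    by rewrite cards0.
  suff XE : X = [set f] by rewrite XE (leq_trans (subset_leq_card (subsetIr _ _))) ?cards1.
  case/setUP: fD => [/E12E fE|/KP[Y YB fY]]; first exact: E1X.
  have [YF _] := BP Y YB; by rewrite (trivIset_eq tiFF XF YF fX fY) YB in XB.
have W0 : 0 < #|W|.
  have /card_gt0P[X XB] := B0; have [_ Xt] := BP X XB.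
  apply: leq_trans (_ : #|verts X| <= _); first by rewrite card_triangle_verts.
  by apply/subset_leq_card/bigcup_sup.
have DW : verts (E12 :|: K) \subset W.
  apply/subsetP => x /vertsP[f /setUP[fE|/KP[X XB fX]] xf].
    by move: fE; rewrite inE => /andP[_ /subsetP]; apply.
  by apply/bigcupP; exists X => //; apply/vertsP; exists f.
have DltW := forest_bound G_simple Df DW W0.
have Kcard : #|B|.*2 <= #|K|.
  rewrite (card_trivIset_cover tiFF KF) -muln2 -sum_nat_const.
  have BF : B \subset FF by apply/subsetP => X /BP[].
  rewrite [leqRHS](big_setID B) /= (setIidPr BF); apply: leq_trans (leq_addr _ _).
  apply: leq_sum => X XB; have [kX <-] := kP X XB; apply: subset_leq_card.
  by rewrite subsetI kX bigcup_sup.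
have Dcard : #|E12 :|: K| = #|E12| + #|K|.
  rewrite cardsU (_ : E12 :&: K = set0) ?cards0 ?subn0 //.
  apply/setP => f; rewrite in_set0; apply/negP => /setIP[/E12E fE /KP[X XB]].
  by rewrite (negbTE (E1B f X fE XB)).
(* Each vertex of [W] is an end of an edge of [O]. Such an edge has two ends in [W] if it is in
   [O2], and at most one otherwise. *)
have Wcard : #|W| <= #|O| + #|O2|.
  have : \sum_(w in W) 1 <= \sum_(w in W) #|inc O w|.
    apply: leq_sum => w /bigcupP[X XB wX]; have [XF _] := BP X XB.
    move: (XB); rewrite inE XF => /cubic_triangleP[_ /(_ w wX)[f fc]].
    apply/card_gt0P; exists f; rewrite in_inc; have [_ _ _ -> _] := fc.
    rewrite inE; apply/exists_inP; exists X => //; apply/existsP; exists w; exact/cornerbP.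
  rewrite sum1_card incidence_sum => /leq_trans; apply.
  have -> : #|O| + #|O2| = \sum_(f in O) (1 + (f \in O2)).
    rewrite big_split /= sum1_card; congr (_ + _); rewrite -sum1_card big_mkcond [RHS]big_mkcond.
    by apply: eq_bigr => f _; rewrite inE; case: (f \in O) => //=; case: (_ \subset _).
  apply: leq_sum => f fO; rewrite [f \in O2]inE fO /=.
  have := subset_leq_card (subsetIl (ends f) W); case: G_simple => /(_ f) f2 _; rewrite f2.
  case: (boolP (ends f \subset W)) => // fW _; rewrite addn0 -ltnS -f2.
  by apply: proper_card; rewrite properE subsetIl subsetI subxx.
(* The edges of [E1] outside [E12] lie in [O] but not in [O2]. *)
have E1card : #|E1| + #|O2| <= #|E12| + #|O|.
  have -> : #|E1| = #|E12| + #|E1 :\: O2|.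
    rewrite -(cardsID O2 E1); congr (_ + _); apply: eq_card => f.
    rewrite in_setI [f \in O2]inE [f \in E12]inE [f \in E1]inE.
    by case: (f \in O) => //=; rewrite andbT.
  rewrite -addnA leq_add2l -(cardsID O2 O) addnC (setIidPr _); last first.
    by apply/subsetP => f; rewrite inE => /andP[].
  by rewrite leq_add2l; apply/subset_leq_card/setSD/subsetP => f; rewrite inE => /andP[].
apply: (@assemble P sel O) => //.
- by move=> X /[dup] /PB[XF Xb] _; case: (selP X XF Xb).
- by move=> X; rewrite !inE => /and3P[].
- by move=> f /OP[X [v [XB c]]]; exists X, v; rewrite inE XB andbF (OB X XB); have [XF _] := BP X XB.
have S1P X : X \in FF :\: B :\: P -> exists2 f, f \in E1 & X = [set f].
  rewrite in_setD inE => /andP[+ /setDP[XF XB]]; rewrite XF XB /= disjoint_subset.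
  case/subsetPn=> f fO; rewrite inE negbK => fX.
  have [[g XE]|] := member_circuits XF; last first.
    by case/(_ f fX)=> C [Cc fC CX]; rewrite (negbTE (Ocircuit f X C fO XF Cc CX)) in fC.
  move: fX XF; rewrite XE => /set1P <- fF; exists f => //.
  by rewrite inE fO.
have S1card : #|FF :\: B :\: P| <= #|E1|.
  rewrite -(card_imset E1 (@set1_inj _)); apply/subset_leq_card/subsetP => X.
  by case/S1P => f fE ->; apply: imset_f.
(* A triangle of [B] has rank at most 2, a member of [P] at most twice its selection, and each
   remaining member is a single edge of [E1]. *)
have rE : r <= #|B|.*2 + (\sum_(X in P) #|sel X|.*2 + #|FF :\: B :\: P|).
  have BF : B \subset FF by apply/subsetP => X /BP[].
  have PFB : P \subset FF :\: B by apply/subsetP => X; rewrite !in_setD inE => /and3P[-> ->].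
  rewrite /r (big_setID B) /= (setIidPr BF) -muln2 -sum_nat_const; apply: leq_add.
    apply: leq_sum => X /BP[_ Xt]; apply: triangle_forest_le2 Xt (subsetIr _ _) _.
    exact: forest_sub (subsetIl _ _) Rf.
  rewrite (big_setID P) /= (setIidPr PFB) -sum1_card; apply: leq_add.
    by apply: leq_sum => X /PB[]; apply: Rsel.
  apply: leq_sum => X /S1P[f _ ->].
  by apply: leq_trans (subset_leq_card (subsetIr _ _)) _; rewrite cards1.
(* From [#|E12| + 2 #|B| < #|W| <= #|O| + #|O2|] and [#|E1| + #|O2| <= #|E12| + #|O|] it follows
   that [#|E1| + 2 #|B| < 2 #|O|]; insert this in [rE]. *)
clear - DltW Kcard Dcard Wcard E1card S1card rE; lia.
Qed.
End Families.

Theorem theorem11 (G H : mgraph) (r : nat) (FF : {set {set edge G}})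
  (G_nonempty : 0 < #|vert G|) (H_nonempty : 0 < #|vert H|)
  (G_simple : simple G) (G_3conn : k_connected 3 G)
  (H_simple : simple H) (H_3conn : k_connected 3 H)
  (H_minor : has_minor H G)
  (FF_fan : fan_family H FF) (FF_free : free_family FF)
  (FF_rank : rank (cover FF) = r) (r_ge1 : 1 <= r) :
  exists F : {set edge G},
    [/\ forest F, #|F| = uphalf r.+1 (* the ceiling of (r + 1) / 2 *)
      & forall e, e \in F -> contractible H e].
Proof.
have H2 : forall h : edge H, #|ends h| = 2 by case: H_simple.
rewrite -FF_rank in r_ge1 *.
exact: (rank_contractible_forest G_simple G_3conn H2 FF_fan FF_free r_ge1).
Qed.
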